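(* Let $\mathbf S$ be a finite set and $\mathcal A=\{A_s\}_{s\in\mathbf S}\subset CQ(\mathbf X,\mathcal H)$ an AVcqC. Then $$\overline C_{A,r}(\mathcal A)\ge\overline C_C(\mathrm{conv}(\mathcal A))=\max_{p\in\mathfrak P(\mathbf X)}\inf_{A\in\mathrm{conv}(\mathcal A)}\chi(p,A).$$
   Context: $\mathbf X$ finite, $\mathcal H$ finite-dimensional complex Hilbert space, $CQ(\mathbf X,\mathcal H)$ the set of maps $\mathbf X\to\mathcal S(\mathcal H)$; $\chi(p,W)=S(\sum_xp(x)W(x))-\sum_xp(x)S(W(x))$ (Holevo information, logs base 2). $A_{s^l}(x^l):=\bigotimes_iA_{s_i}(x_i)$; $\mathrm{conv}(\mathcal A)=\{\sum_sq(s)A_s:q\in\mathfrak P(\mathbf S)\}$. $\overline C_{A,r}(\mathcal A)$ is the supremum of rates $R$ such that there are $(l,M_l)$-random codes (probability measures $\mu_l$ on tuples $(x_i^l,D_i^l)_{i=1}^{M_l}$, $x_i^l\in\mathbf X^l$, $D_i^l\ge0$, $\sum_iD_i^l\le\mathbf 1$) with $\liminf_l\frac1l\log M_l\ge R$ and $\lim_l\max_{s^l}\int\frac1{M_l}\sum_i\mathrm{tr}(A_{s^l}(x_i^l)(\mathbf 1-D_i^l))d\mu_l=0$. $\overline C_C(\mathcal W)$ is the supremum of rates achievable by deterministic codes $(u_m^l,D_m^l)$ with $\lim_l\sup_{W\in\mathcal W}\frac1{M_l}\sum_m\mathrm{tr}(W^{\otimes l}(u_m^l)(\mathbf 1-D_m^l))=0$.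 *)

(* Defs.v *)
From HB Require Import structures.
From mathcomp Require Import all_boot all_order all_algebra.
From mathcomp Require Import all_classical all_reals all_analysis.
From mathcomp Require Import complex.

Set Implicit Arguments.
Unset Strict Implicit.
Unset Printing Implicit Defensive.

Import Order.TTheory GRing.Theory Num.Theory.
Local Open Scope classical_set_scope.
Local Open Scope ring_scope.

Section QDefs.
Context {R : realType}.
Local Notation C := (R[i]).

Definition q_log2 (x : R) : R := ln x / ln 2.

(** positive semidefinite operator on C^n (Hermitian PSD; for complex
    matrices, nonnegativity of the quadratic form implies Hermitian) *)
Definition q_psd {n : nat} (A : 'M[C]_n) : Prop :=
  forall u : 'rV[C]_n, 0 <= (u *m A *m (map_mx (@conjc R) u)^T) ord0 ord0.

Definition q_is_state {n : nat} (rho : 'M[C]_n) : Prop :=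
  q_psd rho /\ \tr rho = 1.

Definition q_eigs {n : nat} (A : 'M[C]_n) : seq C :=
  xget [::] [set s : seq C | char_poly A = \prod_(z <- s) ('X - z%:P)].

(** von Neumann q_entropy S(rho) = - sum_lambda lambda q_log2 lambda (0 log 0 = 0) *)
Definition q_entropy {n : nat} (rho : 'M[C]_n) : R :=
  - \sum_(z <- q_eigs rho) @complex.Re R z * q_log2 (@complex.Re R z).

Definition q_pdist {T : finType} (p : T -> R) : Prop :=
  (forall t, 0 <= p t) /\ \sum_t p t = 1.

Definition q_holevo {X : finType} {d : nat} (p : X -> R) (W : X -> 'M[C]_d) : R :=
  q_entropy (\sum_x (p x)%:C%C *: W x) - \sum_x p x * q_entropy (W x).

Definition q_conv {X S : finType} {d : nat} (A : S -> X -> 'M[C]_d)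
  : set (X -> 'M[C]_d) :=
  [set W | exists q : S -> R, q_pdist q /\ W = (fun x => \sum_s (q s)%:C%C *: A s x)].

(** l-fold tensor power H^{(x) l}: basis indexed by words of length l *)
Definition q_tidx (d l : nat) := {ffun 'I_l -> 'I_d}.
Definition q_tdim (d l : nat) : nat := #|{: q_tidx d l}|.

Definition q_tens {d l : nat} (f : 'I_l -> 'M[C]_d) : 'M[C]_(q_tdim d l) :=
  \matrix_(i, j) \prod_(k < l)
     f k (@enum_val (q_tidx d l) predT i k) (@enum_val (q_tidx d l) predT j k).

Definition q_decoder_valid {M n : nat} (D : 'I_M -> 'M[C]_n) : Prop :=
  (forall m, q_psd (D m)) /\ q_psd (1%:M - \sum_m D m).

Definition q_code_err {X : finType} {d l M : nat} (W : 'I_l -> X -> 'M[C]_d)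
  (u : 'I_M -> 'I_l -> X) (D : 'I_M -> 'M[C]_(q_tdim d l)) : R :=
  (M%:R)^-1 * \sum_m @complex.Re R (\tr (q_tens (fun i => W i (u m i)) *m (1%:M - D m))).

Definition q_det_achievable {X : finType} {d : nat} (Wset : set (X -> 'M[C]_d))
  (r : R) : Prop :=
  exists (M : nat -> nat) (u : forall l, 'I_(M l) -> 'I_l -> X)
         (D : forall l, 'I_(M l) -> 'M[C]_(q_tdim d l)),
    (forall l, 0 < M l)%N /\ (forall l, q_decoder_valid (D l)) /\
    (r%:E <= limn_einf (fun l => (q_log2 (M l)%:R / l%:R)%:E))%E /\
    ((fun l => ereal_sup
        [set (q_code_err (fun _ => W) (u l) (D l))%:E | W in Wset]) @ \oo
       --> 0%E).

Definition q_cap_compound {X : finType} {d : nat} (Wset : set (X -> 'M[C]_d))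
  : \bar R := ereal_sup [set r%:E | r in q_det_achievable Wset].

(** rates achievable by random codes for the AVcqC A.  A random code of
    block length l is a probability space (Om, P) together with a
    code-valued map w |-> (u(w), D(w)); the error functions must be
    measurable (this is equivalent to a probability measure on the set of
    codes with a sigma-algebra making all error functions measurable). *)
Definition q_rand_achievable {X S : finType} {d : nat} (A : S -> X -> 'M[C]_d)
  (r : R) : Prop :=
  exists (M : nat -> nat),
    (forall l, 0 < M l)%N /\
    (r%:E <= limn_einf (fun l => (q_log2 (M l)%:R / l%:R)%:E))%E /\
    exists (dsp : nat -> measure_display)
           (Om : forall l, measurableType (dsp l))
           (P : forall l, probability (Om l) R)
           (u : forall l, Om l -> 'I_(M l) -> 'I_l -> X)
           (D : forall l, Om l -> 'I_(M l) -> 'M[C]_(q_tdim d l)),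
      (forall l w, q_decoder_valid (D l w)) /\
      (forall l (s : 'I_l -> S),
          measurable_fun setT
            (fun w => q_code_err (fun i => A (s i)) (u l w) (D l w))) /\
      ((fun l => ereal_sup
          [set (\int[P l]_w (q_code_err (fun i => A (s i)) (u l w) (D l w))%:E)%E
          | s in [set: 'I_l -> S]]) @ \oo --> 0%E).

Definition q_cap_random {X S : finType} {d : nat} (A : S -> X -> 'M[C]_d)
  : \bar R := ereal_sup [set r%:E | r in q_rand_achievable A].

End QDefs.

(* Main.v *)
Require Import Defs.
From HB Require Import structures.
From mathcomp Require Import all_boot all_order all_algebra.
From mathcomp Require Import all_classical all_reals all_analysis.
From mathcomp Require Import complex.
From mathcomp Require Import ring lra.

(** Achievability.  For a law q on S let W_q be the averaged channel.  Its test
    for the input word x is P Q_x P, with P and Q_x projecting on the typical and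
    conditionally typical product eigenvectors of a slightly depolarized W_q.
    Averaged over i.i.d. inputs it is at most exp (- l (chi - small)) times the
    identity, so it is rarely passed by any state at all; and by Chernoff's bound
    for independent, not necessarily identically distributed, factors it is
    passed by A_(s^l)(x^l) whenever q is the type of s^l.  There are polynomially
    many types, and the tests of all types are turned into one decoder by taking
    increments of N |-> 1 - (1 + N)^-1 along the codebook.  A random codebook
    therefore has a small expected error for every s^l, which is the statement on
    random codes; a single codebook serves all of conv(A), because every q^l is
    dominated by the sum of the t^l over types t.

    Converse.  The Nussbaum-Szkola distributions reduce the error of a code to a
    classical test between product distributions, so Chernoff's bound gives
    log M <= sum_x p_l(x) D(W_x || sigma) + o(1) per letter for each W and each
    full-rank sigma, with p_l the letter frequencies of the code.  This is linear
    in p_l, hence survives passing to a cluster point p, which does not depend on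
    (W, sigma); then sigma tends to sum_x p(x) W_x. *)

Set Implicit Arguments.
Unset Strict Implicit.
Unset Printing Implicit Defensive.

Import Order.TTheory GRing.Theory Num.Theory.
Import numFieldNormedType.Exports.
Local Open Scope ring_scope.
Local Open Scope sesquilinear_scope.

(** * Positive semidefinite matrices *)

Section RealPart.
Context {R : realType}.
Local Notation C := R[i].
Local Notation Re := (@complex.Re R).
Local Notation Im := (@complex.Im R).

Lemma ReD (x y : C) : Re (x + y) = Re x + Re y.
Proof. by case: x; case: y. Qed.
Lemma ReN (x : C) : Re (- x) = - Re x.
Proof. by case: x. Qed.
Lemma ReB (x y : C) : Re (x - y) = Re x - Re y.
Proof. by rewrite ReD ReN. Qed.
Lemma ReZ (a : R) (x : C) : Re (a%:C%C * x) = a * Re x.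
Proof. by case: x => x y /=; rewrite mul0r subr0. Qed.
Lemma Re_sum (I : Type) (s : seq I) (P : pred I) (F : I -> C) :
  Re (\sum_(i <- s | P i) F i) = \sum_(i <- s | P i) Re (F i).
Proof. by apply: (big_morph Re ReD). Qed.
Lemma Re_ge0 (x : C) : 0 <= x -> 0 <= Re x.
Proof. by rewrite lecE => /andP[]. Qed.
Lemma ge0_ReE (x : C) : 0 <= x -> x = (Re x)%:C%C.
Proof. by case: x => x y; rewrite lecE /= => /andP[/eqP -> _]. Qed.

(** The squared modulus, valued in [R] so that it can serve as a real weight. *)
Definition nsq (z : C) : R := Re z ^+ 2 + Im z ^+ 2.

Lemma nsq_ge0 z : 0 <= nsq z.
Proof. by rewrite addr_ge0 // sqr_ge0. Qed.
Lemma nsqE z : z * Num.conj z = (nsq z)%:C%C.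
Proof.
case: z => x y; apply/eqP; rewrite eq_complex /nsq /=; apply/andP; split; apply/eqP; ring.
Qed.
Lemma nsqM z t : nsq (z * t) = nsq z * nsq t.
Proof. by case: z => a b; case: t => c e; rewrite /nsq /=; ring. Qed.
Lemma nsq1 : nsq 1 = 1.
Proof. by rewrite /nsq /=; ring. Qed.
Lemma nsq_prod (I : Type) (s : seq I) (P : pred I) (F : I -> C) :
  nsq (\prod_(i <- s | P i) F i) = \prod_(i <- s | P i) nsq (F i).
Proof. exact: (big_morph nsq nsqM nsq1). Qed.
Lemma nsqC z : nsq (Num.conj z) = nsq z.
Proof. by case: z => a b; rewrite /nsq /= sqrrN. Qed.
Lemma nsqD_le z t : nsq (z + t) <= 2 * (nsq z + nsq t).
Proof.
case: z => a b; case: t => c e; rewrite /nsq /=.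
have := sqr_ge0 (a - c); have := sqr_ge0 (b - e); nra.
Qed.
(** [Re] is multiplicative here because nonnegative complex numbers are real. *)
Lemma Re_prod_ge0 (I : Type) (s : seq I) (P : pred I) (F : I -> C) :
  (forall i, 0 <= F i) ->
  Re (\prod_(i <- s | P i) F i) = \prod_(i <- s | P i) Re (F i).
Proof.
move=> F0; rewrite (eq_bigr (fun i => (Re (F i))%:C%C)) => [|i _]; last exact: ge0_ReE.
by rewrite -(rmorph_prod (real_complex R)).
Qed.
End RealPart.

Section Psd.
Context {R : realType}.
Local Notation C := R[i].
Local Notation Re := (@complex.Re R).

Lemma dagD m n (A B : 'M[C]_(m, n)) : (A + B)^t* = A^t* + B^t*.
Proof. by apply/matrixP => i j; rewrite !mxE rmorphD. Qed.
Lemma dagB m n (A B : 'M[C]_(m, n)) : (A - B)^t* = A^t* - B^t*.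
Proof. by apply/matrixP => i j; rewrite !mxE rmorphB. Qed.
Lemma dagM m n p (A : 'M[C]_(m, n)) (B : 'M[C]_(n, p)) : (A *m B)^t* = B^t* *m A^t*.
Proof. by rewrite trmx_mul map_mxM. Qed.
Lemma dag1 n : (1%:M : 'M[C]_n)^t* = 1%:M.
Proof. by rewrite trmx1 map_mx1. Qed.

Lemma psdP n (A : 'M[C]_n) :
  q_psd A <-> forall u : 'rV[C]_n, 0 <= (u *m A *m u^t*) 0 0.
Proof.
by split=> h u; have := h u; rewrite map_trmx.
Qed.

Lemma psd_congr m n (A : 'M[C]_n) (B : 'M[C]_(m, n)) :
  q_psd A -> q_psd (B *m A *m B^t*).
Proof.
move=> /psdP hA; apply/psdP => u; have := hA (u *m B).
by rewrite trmx_mul map_mxM !mulmxA.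
Qed.

Lemma psdD n (A B : 'M[C]_n) : q_psd A -> q_psd B -> q_psd (A + B).
Proof.
move=> /psdP hA /psdP hB; apply/psdP => u.
by rewrite mulmxDr mulmxDl mxE addr_ge0.
Qed.

Lemma psdZ n (a : R) (A : 'M[C]_n) : 0 <= a -> q_psd A -> q_psd (a%:C%C *: A).
Proof.
move=> a0 /psdP hA; apply/psdP => u.
by rewrite -scalemxAr -scalemxAl mxE mulr_ge0 // ler0c.
Qed.

Lemma psd0 n : q_psd (0 : 'M[C]_n).
Proof. by apply/psdP => u; rewrite mulmx0 mul0mx mxE. Qed.

Lemma psd_sum n (I : Type) (s : seq I) (P : pred I) (F : I -> 'M[C]_n) :
  (forall i, P i -> q_psd (F i)) -> q_psd (\sum_(i <- s | P i) F i).
Proof.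
by move=> h; apply: (big_ind (@q_psd R n)); [exact: psd0|exact: psdD|exact: h].
Qed.

Lemma psd1 n : q_psd (1%:M : 'M[C]_n).
Proof.
apply/psdP => u; rewrite mulmx1 mxE; apply: sumr_ge0 => i _.
by rewrite !mxE nsqE ler0c nsq_ge0.
Qed.

Lemma congr_diag_entry m n (A : 'M[C]_n) (P : 'M[C]_(m, n)) i :
  (P *m A *m P^t*) i i = (row i P *m A *m (row i P)^t*) 0 0.
Proof. by rewrite -row_mul !mxE; apply: eq_bigr => k _; rewrite !mxE. Qed.

Lemma psd_congr_diag m n (A : 'M[C]_n) (P : 'M[C]_(m, n)) i :
  q_psd A -> 0 <= (P *m A *m P^t*) i i.
Proof. by move=> /psdP hA; rewrite congr_diag_entry; apply: hA. Qed.

(* The skew-Hermitian part A - A^* is normal with vanishing quadratic form,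
   hence its eigenvalues vanish. *)
Lemma psd_herm n (A : 'M[C]_n) : q_psd A -> A^t* = A.
Proof.
move=> /psdP hA.
pose B := A - A^t*.
have Bt : B^t* = - B.
  by rewrite /B dagB trmxCK opprB.
have /orthomx_spectralP EB : B \is normalmx.
  by apply/normalmxP; rewrite Bt mulmxN mulNmx.
set P := spectralmx B in EB; set D := spectral_diag B in EB.
have Pu : P \is unitarymx by exact: spectral_unitarymx.
rewrite invmx_unitary // in EB.
have D0 : D = 0.
  apply/matrixP => i j; rewrite ord1 !mxE {i}.
  have : (P *m B *m P^t*) j j = 0.
    rewrite congr_diag_entry; set u := row j P.
    rewrite mulmxBr mulmxBl mxE [X in _ + X]mxE.
    have -> : (u *m A^t* *m u^t*) 0 0 = Num.conj ((u *m A *m u^t*) 0 0).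
      transitivity (((u *m A *m u^t*)^t*) 0 0); last by rewrite !mxE.
      by rewrite !dagM trmxCK mulmxA.
    by rewrite (CrealP _) ?subrr // ger0_real.
  rewrite EB !mulmxA (unitarymxP _) // mul1mx -mulmxA (unitarymxP _) // mulmx1.
  by rewrite !mxE eqxx mulr1n.
have B0 : B = 0.
  rewrite EB D0; have -> : diag_mx (0 : 'rV[C]_n) = 0.
    by apply/matrixP=> i j; rewrite !mxE mul0rn.
  by rewrite mulmx0 mul0mx.
by apply/esym/eqP; rewrite -subr_eq0; apply/eqP.
Qed.

(** Spectral form: for unitary [V] the rows of [V] are left eigenvectors with eigenvalues [r].
    Operators sharing [V] commute, and their algebra and order become pointwise statements about
    [r]. *)
Definition dg n (V : 'M[C]_n) (r : 'I_n -> R) : 'M[C]_n :=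
  V^t* *m diag_mx (\row_j (r j)%:C%C) *m V.

Lemma dg_congr n (V : 'M[C]_n) (u v : 'rV[C]_n) :
  u = v -> V^t* *m diag_mx u *m V = V^t* *m diag_mx v *m V.
Proof. by move=> ->. Qed.

Lemma conj_congr n (V W A B : 'M[C]_n) : A = B -> W *m A *m V = W *m B *m V.
Proof. by move=> ->. Qed.

Lemma dg_ext n (V : 'M[C]_n) (r s : 'I_n -> R) : r =1 s -> dg V r = dg V s.
Proof.
by move=> e; apply: dg_congr; apply/rowP => j; rewrite !mxE e.
Qed.

Lemma psd_dg n (V : 'M[C]_n) r : (forall j, 0 <= r j) -> q_psd (dg V r).
Proof.
move=> r0; rewrite /dg -{2}[V]trmxCK; apply: psd_congr; apply/psdP => u.
rewrite mul_mx_diag mxE; apply: sumr_ge0 => j _; rewrite !mxE.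
by rewrite mulrAC nsqE mulr_ge0 // ler0c // nsq_ge0.
Qed.

Lemma mulmx_cancel_mid n (A B D E F G : 'M[C]_n) :
  D *m E = 1%:M -> (A *m B *m D) *m (E *m F *m G) = A *m (B *m F) *m G.
Proof. by move=> h; rewrite !mulmxA -(mulmxA (A *m B) D E) h mulmx1. Qed.

Lemma dgM n (V : 'M[C]_n) r s : V \is unitarymx ->
  dg V r *m dg V s = dg V (fun j => r j * s j).
Proof.
move=> Vu; rewrite /dg (mulmx_cancel_mid _ _ _ _ (unitarymxP Vu)); apply: conj_congr.
rewrite mul_mx_diag; apply/matrixP => i j; rewrite !mxE mulrnAl rmorphM /=.
by case: eqP => [->|]; rewrite ?mulr1n ?mulr0n.
Qed.

Lemma dgD n (V : 'M[C]_n) r s : dg V r + dg V s = dg V (fun j => r j + s j).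
Proof.
rewrite /dg -mulmxDl -mulmxDr -linearD /=; apply: dg_congr.
by apply/rowP => j; rewrite !mxE rmorphD.
Qed.

Lemma dgZ n (V : 'M[C]_n) a r : a%:C%C *: dg V r = dg V (fun j => a * r j).
Proof.
rewrite /dg scalemxAl scalemxAr -linearZ /=; apply: dg_congr.
by apply/rowP => j; rewrite !mxE rmorphM.
Qed.

Lemma dgB n (V : 'M[C]_n) r s : dg V r - dg V s = dg V (fun j => r j - s j).
Proof.
rewrite -[dg V s]scale1r -scaleNr -(rmorph1 (real_complex R)) -rmorphN dgZ dgD.
by apply: dg_ext => j; rewrite mulN1r.
Qed.

Lemma dg1 n (V : 'M[C]_n) : V \is unitarymx -> dg V (fun=> 1) = 1%:M.
Proof.
move=> Vu; rewrite /dg; have -> : diag_mx (\row_(j < n) (1 : R)%:C%C) = 1%:M.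
  by apply/matrixP => i j; rewrite !mxE rmorph1.
by rewrite mulmx1 -invmx_unitary // mulVmx // unitarymx_unit.
Qed.

(** A Hermitian matrix is normal, and its eigenvalues are diagonal entries of a congruent matrix,
    hence nonnegative. *)
Lemma psd_spectral n (A : 'M[C]_n) : q_psd A ->
  exists V r, [/\ V \is unitarymx, (forall j, 0 <= r j) & A = dg V r].
Proof.
move=> hA; have At := psd_herm hA.
have /orthomx_spectralP EA : A \is normalmx by apply/normalmxP; rewrite At.
set P := spectralmx A in EA; set D := spectral_diag A in EA.
have Pu : P \is unitarymx by exact: spectral_unitarymx.
rewrite invmx_unitary // in EA.
have D0 j : 0 <= D 0 j.
  have := psd_congr_diag P j hA; rewrite EA.
  rewrite !mulmxA (unitarymxP _) // mul1mx -mulmxA (unitarymxP _) // mulmx1.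
  by rewrite !mxE eqxx mulr1n.
exists P, (fun j => Re (D 0 j)); split=> // [j|]; first exact/Re_ge0.
rewrite [LHS]EA; apply: dg_congr.
by apply/rowP => j; rewrite !mxE -ge0_ReE.
Qed.

Lemma dg_entry n (V : 'M[C]_n) r j : V \is unitarymx ->
  (V *m dg V r *m V^t*) j j = (r j)%:C%C.
Proof.
move=> Vu; rewrite /dg !mulmxA (unitarymxP _) // mul1mx -mulmxA (unitarymxP _) // mulmx1.
by rewrite !mxE eqxx mulr1n.
Qed.

Lemma psd_dg_ge0 n (V : 'M[C]_n) r : V \is unitarymx -> q_psd (dg V r) ->
  forall j, 0 <= r j.
Proof.
by move=> Vu h j; have := psd_congr_diag V j h; rewrite dg_entry // ler0c.
Qed.

Lemma Re_trace n (A : 'M[C]_n) : Re (\tr A) = \sum_i Re (A i i).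
Proof. by rewrite -Re_sum. Qed.

(** The Born rule: the probability that a state [rho] passes the test [X], in the real form used by
    [q_code_err]. *)
Definition ev n (rho X : 'M[C]_n) : R := Re (\tr (rho *m X)).

Lemma evDr n (rho X Y : 'M[C]_n) : ev rho (X + Y) = ev rho X + ev rho Y.
Proof. by rewrite /ev mulmxDr linearD /= ReD. Qed.
Lemma evBr n (rho X Y : 'M[C]_n) : ev rho (X - Y) = ev rho X - ev rho Y.
Proof. by rewrite /ev mulmxBr linearB /= ReB. Qed.
Lemma evZr n a (rho X : 'M[C]_n) : ev rho (a%:C%C *: X) = a * ev rho X.
Proof. by rewrite /ev -scalemxAr linearZ /= ReZ. Qed.
Lemma ev_sumr n (I : Type) (s : seq I) (P : pred I) (rho : 'M[C]_n) F :
  ev rho (\sum_(i <- s | P i) F i) = \sum_(i <- s | P i) ev rho (F i).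
Proof. by rewrite /ev mulmx_sumr [\tr _]raddf_sum Re_sum. Qed.
Lemma evC n (rho X : 'M[C]_n) : ev rho X = ev X rho.
Proof. by rewrite /ev mxtrace_mulC. Qed.
Lemma evZl n a (rho X : 'M[C]_n) : ev (a%:C%C *: rho) X = a * ev rho X.
Proof. by rewrite evC evZr evC. Qed.
Lemma ev_suml n (I : Type) (s : seq I) (P : pred I) (X : 'M[C]_n) F :
  ev (\sum_(i <- s | P i) F i) X = \sum_(i <- s | P i) ev (F i) X.
Proof. by rewrite evC ev_sumr; apply: eq_bigr => i _; rewrite evC. Qed.

(* The probability of outcome j when rho is measured in the rows of V. *)
Definition outp n (V rho : 'M[C]_n) (j : 'I_n) : R := Re ((V *m rho *m V^t*) j j).

Lemma ev_dgr n (V rho : 'M[C]_n) g :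
  ev rho (dg V g) = \sum_j g j * outp V rho j.
Proof.
rewrite /ev /dg !mulmxA mxtrace_mulC !mulmxA Re_trace.
apply: eq_bigr => j _; rewrite /outp mul_mx_diag !mxE.
by rewrite [X in Re X]mulrC ReZ.
Qed.

Lemma ev_dgl n (V X : 'M[C]_n) g :
  ev (dg V g) X = \sum_j g j * outp V X j.
Proof. by rewrite evC ev_dgr. Qed.

Lemma outp_ge0 n (V rho : 'M[C]_n) j : q_psd rho -> 0 <= outp V rho j.
Proof. by move=> h; apply/Re_ge0/psd_congr_diag. Qed.

Lemma outp_sum1 n (V rho : 'M[C]_n) : V \is unitarymx -> \tr rho = 1 ->
  \sum_j outp V rho j = 1.
Proof.
move=> Vu h; rewrite /outp -Re_trace mxtrace_mulC mulmxA.
by rewrite -invmx_unitary // mulVmx ?unitarymx_unit // mul1mx h.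
Qed.

Lemma outpZ n (V : 'M[C]_n) a F j : outp V (a%:C%C *: F) j = a * outp V F j.
Proof. by rewrite /outp -scalemxAr -scalemxAl mxE ReZ. Qed.

Lemma outp_sum n (I : Type) (s : seq I) (V : 'M[C]_n) F j :
  outp V (\sum_(i <- s) F i) j = \sum_(i <- s) outp V (F i) j.
Proof. by rewrite /outp mulmx_sumr mulmx_suml summxE Re_sum. Qed.

Lemma outp_suml n (I : Type) (s : seq I) (V : 'M[C]_n) (a : I -> R) F j :
  outp V (\sum_(i <- s) (a i)%:C%C *: F i) j = \sum_(i <- s) a i * outp V (F i) j.
Proof. by rewrite outp_sum; apply: eq_bigr => i _; rewrite outpZ. Qed.

Lemma outp_dg n (V : 'M[C]_n) r j : V \is unitarymx -> outp V (dg V r) j = r j.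
Proof. by move=> Vu; rewrite /outp dg_entry. Qed.

(** Diagonalizing [X] alone suffices: the trace is then a sum of eigenvalues of [X] weighted by
    outcome weights of [rho]. *)
Lemma ev_ge0 n (rho X : 'M[C]_n) : q_psd rho -> q_psd X -> 0 <= ev rho X.
Proof.
move=> hr /psd_spectral[V [r [Vu r0 ->]]]; rewrite ev_dgr.
by apply: sumr_ge0 => j _; rewrite mulr_ge0 // outp_ge0.
Qed.

Lemma ler_ev n (rho X Y : 'M[C]_n) : q_psd rho -> q_psd (Y - X) -> ev rho X <= ev rho Y.
Proof. by move=> hr h; rewrite -subr_ge0 -evBr ev_ge0. Qed.

Lemma ev_state1 n (rho : 'M[C]_n) : q_is_state rho -> ev rho 1%:M = 1.
Proof. by case=> _ h; rewrite /ev mulmx1 h. Qed.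

End Psd.

(** * Decoding and testing operators *)

Section Resolvent.
Context {R : realType}.
Local Notation C := R[i].
Variable n : nat.
Implicit Types (N E A rho : 'M[C]_n).

Definition rsv N : 'M[C]_n := invmx (1%:M + N).

(** A kernel vector [v] makes the nonnegative numbers [v v^*] and [v N v^*] sum to zero, so
    [v = 0]. *)
Lemma rsv_unit N : q_psd N -> 1%:M + N \in unitmx.
Proof.
move=> /psdP hN; rewrite -row_free_unit -kermx_eq0; apply/rowV0P => v /sub_kermxP.
rewrite mulmxDr mulmx1 => h.
have : (v *m v^t*) 0 0 + (v *m N *m v^t*) 0 0 = 0.
  have := congr1 (fun M => (M *m v^t*) 0 0) h; rewrite mulmxDl mul0mx.
  by rewrite [X in X = _]mxE [X in _ = X]mxE.
have /psdP/(_ v) := @psd1 R n; rewrite mulmx1 => v0.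
move/eqP; rewrite paddr_eq0 // => /andP[/eqP vv0 _].
apply/rowP => j; rewrite !mxE; move/eqP: vv0; rewrite mxE psumr_eq0 => [|i _]; last first.
  by rewrite !mxE nsqE ler0c nsq_ge0.
move=> /allP/(_ j); rewrite mem_index_enum !mxE => /(_ isT).
by rewrite mul_conjC_eq0 => /eqP.
Qed.

Lemma rsv_dg V (r : 'I_n -> R) : V \is unitarymx -> (forall j, 0 <= r j) ->
  rsv (dg V r) = dg V (fun j => (1 + r j)^-1).
Proof.
move=> Vu r0.
have h : (1%:M + dg V r) *m dg V (fun j => (1 + r j)^-1) = 1%:M.
  rewrite -(dg1 Vu) dgD (dgM _ _ Vu); apply: dg_ext => j.
  by rewrite mulfV // gt_eqF // ltr_wpDr.
have u : 1%:M + dg V r \in unitmx by apply/rsv_unit/psd_dg.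
by have := congr1 (mulmx (rsv (dg V r))) h; rewrite mulmxA mulVmx // mul1mx mulmx1.
Qed.

Lemma rsv_psd N : q_psd N -> q_psd (rsv N).
Proof.
move=> /psd_spectral[V [r [Vu r0 ->]]]; rewrite (rsv_dg Vu r0); apply: psd_dg => j.
by rewrite invr_ge0 addr_ge0.
Qed.

Lemma rsv_ge N : q_psd N -> q_psd (N - (1%:M - rsv N)).
Proof.
move=> /psd_spectral[V [r [Vu r0 ->]]]; rewrite (rsv_dg Vu r0) -(dg1 Vu) !dgB.
apply: psd_dg => j; have r1 : 0 < 1 + r j by rewrite ltr_wpDr.
have -> : r j - (1 - (1 + r j)^-1) = r j ^+ 2 / (1 + r j).
  by field; rewrite gt_eqF.
by rewrite divr_ge0 ?sqr_ge0 // ltW.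
Qed.

(** For a large weight [c] the resolvent of a test hardly exceeds the failure operator [1 - E]. On
    eigenvalues, [(1 + c e)^-1] is convex in [e] and so lies below its chord over [[0, 1]]; the
    proof exhibits the difference as a nonnegative fraction. *)
Lemma rsv_scale_le (c : R) E : 0 < c -> q_psd E -> q_psd (1%:M - E) ->
  q_psd (1%:M - E + ((1 + c)^-1)%:C%C *: 1%:M - rsv (c%:C%C *: E)).
Proof.
move=> c0 /psd_spectral[V [e [Vu e0 ->]]].
have ce0 j : 0 <= c * e j by rewrite mulr_ge0 // ltW.
rewrite -(dg1 Vu) !dgB !dgZ (rsv_dg Vu ce0) => h.
rewrite dgD dgB; apply: psd_dg => j.
have e1 : e j <= 1 by have := psd_dg_ge0 Vu h j; rewrite subr_ge0.
have ej := e0 j.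
have p1 : 0 < 1 + c * e j by rewrite ltr_wpDr // mulr_ge0 // ltW.
have p2 : 0 < 1 + c by rewrite addr_gt0.
have -> : 1 - e j + (1 + c)^-1 * 1 - (1 + c * e j)^-1 =
  (1 - e j) * (1 + c * e j + c ^+ 2 * e j) / ((1 + c) * (1 + c * e j)).
  by field; rewrite !gt_eqF.
by rewrite !mulr_ge0 ?invr_ge0 ?subr_ge0 ?addr_ge0 ?mulr_ge0 ?sqr_ge0 ?(ltW c0) ?(ltW p1) ?(ltW p2).
Qed.

(** With [X = N' - N] and [B = rsv N'], the difference of resolvents equals
    [B X B + B X (rsv N) X B], a sum of two congruences of positive matrices. *)
Lemma rsv_anti N N' : q_psd N -> q_psd (N' - N) -> q_psd (rsv N - rsv N').
Proof.
move=> hN hX; set X := N' - N.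
have hN' : q_psd N' by rewrite -[N'](subrK N); apply: psdD.
have uN := rsv_unit hN; have uN' := rsv_unit hN'.
have hB := psd_herm (rsv_psd hN').
have XE : X = (1%:M + N') - (1%:M + N) by rewrite /X opprD addrACA subrr add0r.
have -> : rsv N - rsv N' = rsv N' *m X *m (rsv N')^t* +
    (rsv N' *m X) *m rsv N *m (rsv N' *m X)^t*.
  rewrite dagM (psd_herm hX) hB.
  have -> : rsv N' *m X *m rsv N' + rsv N' *m X *m rsv N *m (X *m rsv N')
          = rsv N' *m X *m rsv N *m (1%:M + N + X) *m rsv N'.
    by rewrite mulmxDr mulmxDl !mulmxA mulmxKV.
  have -> : 1%:M + N + X = 1%:M + N' by rewrite XE addrC subrK.
  rewrite -[RHS]mulmxA mulmxV // mulmx1.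
  by rewrite XE mulmxBr mulVmx // mulmxBl mul1mx -mulmxA mulmxV // mulmx1.
by apply: psdD; apply: psd_congr; [exact: hX|exact: (rsv_psd hN)].
Qed.

Lemma rsv0 : rsv 0 = 1%:M.
Proof. by rewrite /rsv addr0 invmx1. Qed.

End Resolvent.

(* Decoding with increments of the operator monotone map
   N |-> 1 - (1 + N)^-1 along the partial sums of the tests: the increments
   are positive and telescope, so no square roots are needed. *)
Section IncrementDecoder.
Context {R : realType}.
Local Notation C := R[i].
Variables (n M : nat) (A : 'I_M -> 'M[C]_n) (c : R).
Hypotheses (A_psd : forall i, q_psd (A i)) (c_gt0 : 0 < c).

Definition test_sum (k : nat) : 'M[C]_n := \sum_(i < M | (i < k)%N) c%:C%C *: A i.

Definition inc_decoder (m : 'I_M) : 'M[C]_n := rsv (test_sum m) - rsv (test_sum m.+1).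

Lemma test_sum_psd k : q_psd (test_sum k).
Proof. by apply: psd_sum => i _; apply: psdZ => //; apply: ltW. Qed.

Lemma test_sumS (m : 'I_M) : test_sum m.+1 = c%:C%C *: A m + test_sum m.
Proof.
rewrite /test_sum (bigD1 m) //=; congr (_ + _); apply: eq_bigl => i.
by rewrite ltnS ltn_neqAle andbC.
Qed.

Lemma inc_decoder_valid : q_decoder_valid inc_decoder.
Proof.
split=> [m|].
  apply: rsv_anti; first exact: test_sum_psd.
  by rewrite test_sumS addrK; apply: psdZ => //; apply: ltW.
have -> : \sum_m inc_decoder m = rsv (test_sum 0) - rsv (test_sum M).
  rewrite /inc_decoder -(big_mkord xpredT (fun m => rsv (test_sum m) - rsv (test_sum m.+1))).
  rewrite -[LHS]opprK -sumrN; under eq_bigr do rewrite opprB.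
  by rewrite telescope_sumr // opprB.
rewrite {1}/test_sum big_pred0 // rsv0 subKr; exact/rsv_psd/test_sum_psd.
Qed.

(** The failure operator splits into [rsv (test_sum m.+1)], small when [rho] passes [E] because
    [test_sum m.+1] dominates [c E], and [1 - rsv (test_sum m)], which is at most [test_sum m]: the
    false alarms of earlier messages only. *)
Lemma inc_decoder_err (rho E : 'M[C]_n) m : q_is_state rho ->
  q_psd E -> q_psd (1%:M - E) -> q_psd (A m - E) ->
  ev rho (1%:M - inc_decoder m) <=
  ev rho (1%:M - E) + (1 + c)^-1 + c * \sum_(i < M | (i < m)%N) ev rho (A i).
Proof.
move=> hr hE hE1 hAE; have [rp _] := hr.
have -> : 1%:M - inc_decoder m = (1%:M - rsv (test_sum m)) + rsv (test_sum m.+1).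
  by rewrite /inc_decoder opprB addrA addrAC.
rewrite evDr addrC; apply: lerD.
  have h1 := rsv_scale_le c_gt0 hE hE1.
  have h2 : q_psd (rsv (c%:C%C *: E) - rsv (test_sum m.+1)).
    apply: rsv_anti; first exact: (psdZ (ltW c_gt0)).
    rewrite test_sumS addrAC -scalerBr; apply: psdD; last exact: test_sum_psd.
    exact: (psdZ (ltW c_gt0)).
  apply: le_trans (ler_ev rp h2) _; apply: le_trans (ler_ev rp h1) _.
  by rewrite evDr evZr ev_state1 // mulr1.
apply: le_trans (ler_ev rp (rsv_ge (test_sum_psd m))) _.
rewrite /test_sum ev_sumr mulr_sumr le_eqVlt; apply/orP; left; apply/eqP.
by apply: eq_bigr => i _; rewrite evZr.
Qed.

End IncrementDecoder.

(** The parallelogram law for the form defined by [X]. It replaces the Cauchy-Schwarz inequality in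
    bounding the disturbance caused by a projection. *)
Lemma ev_parallelogram {R : realType} n (rho A X : 'M[R[i]]_n) :
  ev rho ((1%:M - A) *m X *m (1%:M - A)) + ev rho ((1%:M + A) *m X *m (1%:M + A)) =
  2 * ev rho X + 2 * ev rho (A *m X *m A).
Proof.
rewrite !mulmxDl !mulmxDr !mul1mx !mulmx1 !mulNmx !mulmxN opprK.
have N Y : ev rho (- Y) = - ev rho Y.
  by rewrite -scaleN1r -(rmorph1 (real_complex R)) -rmorphN evZr mulN1r.
rewrite !evDr !N.
move: (ev rho X) (ev rho (A *m X)) (ev rho (X *m A)) (ev rho (A *m X *m A)).
by move=> a b c e; ring.
Qed.

(** * Tests sandwiched between projections *)

Section Projections.
Context {R : realType}.
Local Notation C := R[i].
Variables (n : nat) (P Q : 'M[C]_n).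
Hypotheses (Pt : P^t* = P) (PP : P *m P = P) (Q_psd : q_psd Q) (Q1_psd : q_psd (1%:M - Q)).

Lemma psd_conj_herm (B X : 'M[C]_n) : B^t* = B -> q_psd X -> q_psd (B *m X *m B).
Proof. by move=> e h; rewrite -{2}e; apply: psd_congr. Qed.

Let P1 := 1%:M - P.
Let P1t : P1^t* = P1.
Proof. by rewrite /P1 dagB Pt dag1. Qed.
Let P1P1 : P1 *m P1 = P1.
Proof. by rewrite /P1 mulmxBl mul1mx mulmxBr mulmx1 PP subrr subr0. Qed.

Lemma sandwich_psd : q_psd (P *m Q *m P).
Proof. exact: psd_conj_herm. Qed.

Lemma sandwich_le1 : q_psd (1%:M - P *m Q *m P).
Proof.
have -> : 1%:M - P *m Q *m P = P1 *m 1%:M *m P1 + P *m (1%:M - Q) *m P.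
  by rewrite mulmx1 P1P1 mulmxBr mulmx1 mulmxBl PP /P1 addrA subrK.
apply: psdD; first exact: (psd_conj_herm P1t (@psd1 R n)).
exact: (psd_conj_herm Pt Q1_psd).
Qed.

(** One has [1 - P Q P = P1 + P Q1 P] with [P1 = 1 - P] and [Q1 = 1 - Q]. The parallelogram law
    bounds [P Q1 P] by [2 Q1 + 2 P1 Q1 P1], and [P1 Q1 P1] is at most [P1]. *)
Lemma ev_sandwich (rho : 'M[C]_n) : q_psd rho ->
  ev rho (1%:M - P *m Q *m P) <= 3 * ev rho (1%:M - P) + 2 * ev rho (1%:M - Q).
Proof.
move=> hr; set Q1 := 1%:M - Q.
have h1 : q_psd (P1 *m Q *m P1) by exact: psd_conj_herm.
have h2 : q_psd ((1%:M + P1) *m Q1 *m (1%:M + P1)).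
  by apply: (psd_conj_herm _ Q1_psd); rewrite dagD P1t dag1.
have e1 : 1%:M - P *m Q *m P = P1 + P *m Q1 *m P.
  by rewrite /Q1 mulmxBr mulmx1 mulmxBl PP /P1 addrA subrK.
have PE : P = 1%:M - P1 by rewrite /P1 subKr.
have e2 : P1 *m Q *m P1 = P1 - P1 *m Q1 *m P1.
  by rewrite /Q1 (mulmxBr P1 1%:M Q) mulmx1 (mulmxBl P1 (P1 *m Q) P1) P1P1 subKr.
have k1 : 0 <= ev rho P1 - ev rho (P1 *m Q1 *m P1).
  by rewrite -evBr -e2; exact: (ev_ge0 hr h1).
have := ev_ge0 hr h2; have := ev_parallelogram rho P1 Q1; rewrite -PE.
rewrite e1 (evDr rho P1) -/P1.
move: k1; move: (ev rho P1) (ev rho Q1) (ev rho (P1 *m _ *m _)) (ev rho (P *m _ *m _)).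
by move: (ev _ _) => a b c e f; lra.
Qed.

End Projections.

(** * Reduction of quantum tests to classical ones *)

Section NussbaumSzkola.
Context {R : realType}.
Local Notation C := R[i].
Variables (n : nat) (U V T : 'M[C]_n) (r s : 'I_n -> R) (g : R).
Hypotheses (Uu : U \is unitarymx) (Vu : V \is unitarymx).
Hypotheses (r_ge0 : forall a, 0 <= r a) (s_ge0 : forall b, 0 <= s b) (g_ge0 : 0 <= g).
Hypotheses (T_psd : q_psd T) (T1_psd : q_psd (1%:M - T)).

Definition overlap (a b : 'I_n) : R := nsq ((U *m V^t*) a b).

Lemma psd_sub_sqr (X : 'M[C]_n) : q_psd X -> q_psd (1%:M - X) -> q_psd (X - X *m X).
Proof.
move=> /psd_spectral[W [e [Wu e0 ->]]]; rewrite -(dg1 Wu) dgB (dgM _ _ Wu) dgB => h.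
apply: psd_dg => j; have := psd_dg_ge0 Wu h j; have := e0 j; nra.
Qed.

(** The left side is a diagonal entry of [W X^2 W^*] expanded in the basis [W'], and [X^2 <= X] for
    [0 <= X <= 1]. *)
Lemma outp_sqr (W W' X : 'M[C]_n) a : W' \is unitarymx -> q_psd X ->
  q_psd (1%:M - X) -> \sum_b nsq ((W *m X *m W'^t*) a b) <= outp W X a.
Proof.
move=> W'u hX hX1; have := psd_congr_diag W a (psd_sub_sqr hX hX1).
rewrite mulmxBr mulmxBl mxE => /Re_ge0; rewrite ReD -/(outp W X a) [X in _ + X](_ : _ = - \sum_b nsq ((W *m X *m W'^t*) a b)); first by rewrite subr_ge0.
rewrite mxE ReN; congr (- _).
have -> : W *m (X *m X) *m W^t* = (W *m X *m W'^t*) *m (W *m X *m W'^t*)^t*.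
  rewrite !dagM trmxCK (psd_herm hX) !mulmxA.
  by rewrite -(invmx_unitary W'u) mulmxKV ?unitarymx_unit.
by rewrite mxE Re_sum; apply: eq_bigr => b _; rewrite !mxE nsqE.
Qed.

(* Quantum errors are bounded below by those of the classical test between the
   distributions r_a |<a|b>|^2 and s_b |<a|b>|^2. *)
Lemma nussbaum_szkola :
  2^-1 * (\sum_a \sum_b if r a <= g * s b then r a * overlap a b else 0) <=
  ev (dg U r) (1%:M - T) + g * ev (dg V s) T.
Proof.
set x := fun a b => nsq ((U *m (1%:M - T) *m V^t*) a b).
set y := fun a b => nsq ((U *m T *m V^t*) a b).
have h1 : \sum_a \sum_b r a * x a b <= ev (dg U r) (1%:M - T).
  rewrite ev_dgl; apply: ler_sum => a _; rewrite -mulr_sumr ler_wpM2l //.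
  by apply: outp_sqr => //; rewrite subKr.
have h2 : \sum_a \sum_b s b * y a b <= ev (dg V s) T.
  rewrite exchange_big ev_dgl; apply: ler_sum => b _; rewrite -mulr_sumr ler_wpM2l //.
  apply: le_trans (outp_sqr V b Uu T_psd T1_psd); apply: ler_sum => a _.
  rewrite /y -nsqC le_eqVlt; apply/orP; left; apply/eqP; congr nsq.
  transitivity (((U *m T *m V^t*)^t*) b a); first by rewrite !mxE.
  by rewrite !dagM trmxCK (psd_herm T_psd) mulmxA.
apply: le_trans (lerD h1 (ler_wpM2l g_ge0 h2)).
rewrite !mulr_sumr -big_split; apply: ler_sum => a _ /=.
rewrite !mulr_sumr -big_split; apply: ler_sum => b _ /=.
have x0 : 0 <= x a b := nsq_ge0 _; have y0 : 0 <= y a b := nsq_ge0 _.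
have ra := r_ge0 a; have sb := s_ge0 b.
case: ifPn => [le_rs|_]; last by rewrite mulr0 addr_ge0 ?mulr_ge0.
(* The amplitude is split by [1 = (1 - T) + T]; the factor 2 lost here is the [2^-1] of the
   statement. *)
have : overlap a b <= 2 * (x a b + y a b).
  rewrite /overlap -[U *m V^t*](_ : U *m (1%:M - T) *m V^t* + U *m T *m V^t* = _).
    by rewrite mxE; apply: nsqD_le.
  by rewrite -mulmxDl -mulmxDr subrK mulmx1.
move=> ov; rewrite mulrA.
have := ler_wpM2l ra ov; have := ler_wpM2r y0 le_rs; lra.
Qed.

End NussbaumSzkola.

(** * Product measures and the Chernoff bound *)

Section ProductMeasure.
Context {R : realType}.
Variables (I Y : finType) (w : I -> Y -> R).

Definition prodw (f : {ffun I -> Y}) : R := \prod_i w i (f i).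

Lemma prodw_ge0 f : (forall i y, 0 <= w i y) -> 0 <= prodw f.
Proof. by move=> h; apply: prodr_ge0. Qed.

Hypothesis w1 : forall i, \sum_y w i y = 1.

Lemma prodw_sum1 : \sum_f prodw f = 1.
Proof. by rewrite -bigA_distr_bigA big1. Qed.

Lemma prodw_marginal (m : I) (h : Y -> R) :
  \sum_f prodw f * h (f m) = \sum_y w m y * h y.
Proof.
pose F i y := w i y * (if i == m then h y else 1).
transitivity (\sum_f \prod_i F i ((f : {ffun I -> Y}) i)).
  apply: eq_bigr => f _; rewrite /F big_split; congr (_ * _) => /=.
  by rewrite (bigD1 m) //= eqxx big1 ?mulr1 // => i /negPf ->.
rewrite -bigA_distr_bigA (bigD1 m) //= [X in _ * X]big1 ?mulr1 => [|i /negPf im].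
  by apply: eq_bigr => y _; rewrite /F eqxx.
by rewrite -[RHS](w1 i); apply: eq_bigr => y _; rewrite /F im mulr1.
Qed.

(** Since [h] need not factor, the value [z] of [f k] is first fixed by an indicator; the summand is
    then a product over coordinates. *)
Lemma prodw_marginal2 (m k : I) (h : Y -> Y -> R) : m != k ->
  \sum_f prodw f * h (f m) (f k) = \sum_y \sum_z w m y * w k z * h y z.
Proof.
move=> mk.
transitivity (\sum_z \sum_f prodw f * (h (f m) z * (f k == z)%:R)).
  rewrite exchange_big; apply: eq_bigr => f _ /=.
  rewrite (bigD1 (f k)) //= eqxx mulr1 big1 ?addr0 // => z.
  by rewrite eq_sym => /negPf ->; rewrite !mulr0.
rewrite [RHS]exchange_big; apply: eq_bigr => z _ /=.
pose F i y := w i y * (if i == m then h y z else if i == k then (y == z)%:R else 1).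
transitivity (\sum_f \prod_i F i ((f : {ffun I -> Y}) i)).
  apply: eq_bigr => f _; rewrite /F big_split; congr (_ * _) => /=.
  rewrite (bigD1 m) //= eqxx (bigD1 k) 1?eq_sym //= (eq_sym k) (negPf mk) eqxx.
  by rewrite big1 ?mulr1 // => i /andP[/negPf -> /negPf ->].
rewrite -bigA_distr_bigA (bigD1 m) //= (bigD1 k) 1?eq_sym //= [X in _ * (_ * X)]big1 ?mulr1; last first.
  move=> i /andP[/negPf im /negPf ik].
  by rewrite -[RHS](w1 i); apply: eq_bigr => y _; rewrite /F im ik mulr1.
have -> : \sum_y F k y = w k z.
  rewrite (bigD1 z) //= /F (eq_sym k) (negPf mk) eqxx eqxx mulr1 big1 ?addr0 // => y /negPf ->.
  by rewrite mulr0.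
by rewrite mulr_suml; apply: eq_bigr => y _; rewrite /F eqxx mulrAC.
Qed.
End ProductMeasure.

Section Chernoff.
Context {R : realType}.

(** From [1 - y <= exp (- y)] one gets [(1 - y) exp y <= 1], while [(1 - y) (1 + y + 2 y^2) = 1 +
    y^2 (1 - 2 y)] is at least 1. *)
Lemma expR_le_quadratic (y : R) : y <= 2^-1 -> expR y <= 1 + y + 2 * y ^+ 2.
Proof.
move=> y2.
have h := expR_ge1Dx (- y); rewrite expRN in h.
have e0 : 0 < expR y := expR_gt0 y.
have h' : (1 - y) * expR y <= 1.
  by rewrite -[leRHS](mulVf (lt0r_neq0 e0)) ler_wpM2r // ltW.
have p : 0 < 1 - y by lra.
have q : 1 <= (1 - y) * (1 + y + 2 * y ^+ 2).
  have h0 : 0 <= y ^+ 2 * (1 - 2 * y) by apply: mulr_ge0; [exact: sqr_ge0|lra].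
  by lra.
by rewrite -(ler_pM2l p); apply: le_trans h' q.
Qed.

(** The centred variable is at most [2 B] in absolute value; in the quadratic bound the linear term
    averages to zero and the rest is [2 (2 B)^2 t^2]. *)
Lemma mgf_bound (Y : finType) (w : Y -> R) (Z : Y -> R) (B t : R) :
  q_pdist w -> (forall y, `|Z y| <= B) -> 0 <= t -> 2 * B * t <= 2^-1 ->
  \sum_y w y * expR (t * (Z y - \sum_y' w y' * Z y')) <= expR (8 * B ^+ 2 * t ^+ 2).
Proof.
move=> [w0 w1] ZB t0 Bt; set m := \sum_y' w y' * Z y'.
have mB : `|m| <= B.
  apply: le_trans (ler_norm_sum _ _ _) _.
  rewrite -[leRHS]mul1r -w1 mulr_suml; apply: ler_sum => y _.
  by rewrite normrM ger0_norm // ler_wpM2l.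
apply: le_trans (expR_ge1Dx _).
have -> : 1 + 8 * B ^+ 2 * t ^+ 2 =
  \sum_y w y * (1 + t * (Z y - m) + 8 * B ^+ 2 * t ^+ 2).
  under eq_bigr do rewrite mulrDr mulrDr mulr1 mulrCA mulrBr.
  rewrite !big_split /= w1 -mulr_suml w1 mul1r -mulr_sumr big_split /= -/m sumrN.
  by rewrite -mulr_suml w1 mul1r subrr mulr0 addr0.
apply: ler_sum => y _; rewrite ler_wpM2l //.
have /ler_normlP[z1 z2] := ZB y; have /ler_normlP[m1 m2] := mB.
have u1 : Z y - m <= 2 * B by lra.
have u2 : - (2 * B) <= Z y - m by lra.
apply: le_trans (expR_le_quadratic _) _.
  apply: le_trans Bt; rewrite mulrC ler_wpM2r //.
rewrite lerD2l; have : (Z y - m) ^+ 2 <= (2 * B) ^+ 2.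
  by rewrite -ler_sqrt ?sqr_ge0 // !sqrtr_sqr ler_norml; apply/andP; split;
     rewrite ?(le_trans _ u2) ?(le_trans u1) ?lerN2 ?ler_norm.
move=> h; rewrite exprMn; have := ler_wpM2l (sqr_ge0 t) h; lra.
Qed.

(** Half of [t dl] for the parameter [t = dl / (16 (B + dl)^2)] of [chernoff_tail]. Using [B + dl]
    instead of [B] covers [B = 0] and keeps [2 B t] below [2^-1]. *)
Definition chernoff_exp (B dl : R) : R := dl ^+ 2 / (32 * (B + dl) ^+ 2).

Lemma chernoff_exp_gt0 B dl : 0 <= B -> 0 < dl -> 0 < chernoff_exp B dl.
Proof. by move=> B0 d0; rewrite divr_gt0 ?mulr_gt0 ?exprn_gt0 // ltr_wpDl. Qed.

Lemma chernoff_tail (Y : finType) (l : nat) (w Z : 'I_l -> Y -> R) (B dl : R) :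
  0 <= B -> 0 < dl -> (forall i, q_pdist (w i)) -> (forall i y, `|Z i y| <= B) ->
  \sum_(y : {ffun 'I_l -> Y} |
      \sum_i \sum_y' w i y' * Z i y' + l%:R * dl <= \sum_i Z i (y i)) prodw w y
  <= expR (- (l%:R * chernoff_exp B dl)).
Proof.
move=> B0 d0 hw ZB.
set B' := B + dl; have B'0 : 0 < B' by rewrite ltr_wpDl.
pose t := dl / (16 * B' ^+ 2).
have t0 : 0 < t by rewrite divr_gt0 ?mulr_gt0 ?exprn_gt0.
have w0 i y : 0 <= w i y by case: (hw i).
pose m i := \sum_y' w i y' * Z i y'.
(* Markov's inequality in exponential form: on the tail event the exponential factor is at least 1.
   The factors may have different laws, since only the product structure is used. *)
have step (y : {ffun 'I_l -> Y}) : \sum_i m i + l%:R * dl <= \sum_i Z i (y i) ->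
    prodw w y <= expR (- (t * (l%:R * dl))) * \prod_i (w i (y i) * expR (t * (Z i (y i) - m i))).
  move=> h; rewrite big_split /= mulrCA -[leLHS]mulr1 ler_wpM2l ?prodw_ge0 //.
  rewrite -expR_sum -expRD -[leLHS]expR0 ler_expR -mulr_sumr -mulrN -mulrDr.
  by rewrite pmulr_rge0 // sumrB; move: h; lra.
apply: (@le_trans _ _ (\sum_(y : {ffun 'I_l -> Y}) expR (- (t * (l%:R * dl))) *
    \prod_i (w i (y i) * expR (t * (Z i (y i) - m i))))).
  rewrite big_mkcond; apply: ler_sum => y _; case: ifP => [|_]; first exact: step.
  by rewrite mulr_ge0 ?expR_ge0 // prodr_ge0 // => i _; rewrite mulr_ge0 ?expR_ge0.
rewrite -mulr_sumr -(bigA_distr_bigA (fun i y => w i y * expR (t * (Z i y - m i)))).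
apply: (@le_trans _ _ (expR (- (t * (l%:R * dl))) * \prod_(i < l) expR (8 * B ^+ 2 * t ^+ 2))).
  rewrite ler_wpM2l ?expR_ge0 //; apply: ler_prod => i _.
  rewrite sumr_ge0 => [|y _]; last by rewrite mulr_ge0 ?expR_ge0.
  apply: mgf_bound => //; first exact: ltW.
  rewrite /t mulrA ler_pdivrMr ?mulr_gt0 ?exprn_gt0 //.
  have : B * dl <= B' ^+ 2 by rewrite /B' expr2; nra.
  by nra.
rewrite prodr_const card_ord -expRM_natl -expRD ler_expR.
have -> : chernoff_exp B dl = t * dl / 2.
  by rewrite /chernoff_exp /t -/B'; field; rewrite gt_eqF.
have : 8 * B ^+ 2 * t ^+ 2 <= t * dl / 2.
  have BB : B ^+ 2 <= B' ^+ 2 by rewrite ler_sqr ?nnegrE ?(ltW B'0) // /B' lerDl ltW.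
  have e : t * (16 * B' ^+ 2) = dl by rewrite /t divfK // gt_eqF // mulr_gt0 ?exprn_gt0.
  rewrite -e; have := ler_wpM2l (sqr_ge0 t) BB; lra.
move=> h; have := ler_wpM2l (ler0n R l) h; lra.
Qed.
End Chernoff.

(** * Tensor powers *)

Section Tensor.
Context {R : realType}.
Local Notation C := R[i].
Local Notation Re := (@complex.Re R).
Variables d l : nat.
Local Notation word := {ffun 'I_l -> 'I_d}.
Implicit Types f g V rho : 'I_l -> 'M[C]_d.

Definition wd (k : 'I_(q_tdim d l)) : word := @enum_val (q_tidx d l) predT k.

Lemma sum_wd (V : nmodType) (F : word -> V) : \sum_k F (wd k) = \sum_w F w.
Proof.
by rewrite [RHS](reindex wd) //=; apply/onW_bij/enum_val_bij.
Qed.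

Lemma wd_inj : injective wd.
Proof. exact: enum_val_inj. Qed.

Lemma tensE f i j : q_tens f i j = \prod_k f k (wd i k) (wd j k).
Proof. by rewrite mxE. Qed.

Lemma tens_ext f g : (forall i, f i = g i) -> q_tens f = q_tens g.
Proof. by move=> e; apply/matrixP => i j; rewrite !tensE; apply: eq_bigr => k _; rewrite e. Qed.

Lemma tensM f g : q_tens f *m q_tens g = q_tens (fun i => f i *m g i).
Proof.
apply/matrixP => i j; rewrite mxE tensE.
under [LHS]eq_bigr do rewrite !tensE -big_split /=.
rewrite (sum_wd (fun w => \prod_k (f k (wd i k) (w k) * g k (w k) (wd j k)))).
rewrite -(bigA_distr_bigA (fun k x => f k (wd i k) x * g k x (wd j k))).
by apply: eq_bigr => k _; rewrite mxE.
Qed.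

Lemma tens_dag f : (q_tens f)^t* = q_tens (fun i => (f i)^t*).
Proof.
apply/matrixP => i j; rewrite !mxE rmorph_prod.
by apply: eq_bigr => k _; rewrite !mxE.
Qed.

Lemma tens1 : q_tens (fun=> 1%:M) = 1%:M :> 'M[C]_(q_tdim d l).
Proof.
apply/matrixP => i j; rewrite tensE [RHS]mxE.
case: eqVneq => [->|ij]; first by rewrite big1 // => k _; rewrite mxE eqxx.
have : exists k, wd i k != wd j k.
  apply/existsP; rewrite -negb_forall; apply: contra ij => /forallP h.
  by apply/eqP/wd_inj/ffunP => k; apply/eqP.
by case=> k hk; rewrite (bigD1 k) //= mxE (negPf hk) mul0r.
Qed.

Lemma tens_unitary V : (forall i, V i \is unitarymx) -> q_tens V \is unitarymx.
Proof.
move=> h; apply/unitarymxP; rewrite tens_dag tensM -tens1; apply: tens_ext => i.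
exact/unitarymxP.
Qed.

Lemma tens_tr f : \tr (q_tens f) = \prod_i \tr (f i).
Proof.
rewrite [LHS](_ : _ = \sum_k \prod_i f i (wd k i) (wd k i)); last by apply: eq_bigr => k _; rewrite tensE.
by rewrite (sum_wd (fun w => \prod_i f i (w i) (w i))) -(bigA_distr_bigA (fun i x => f i x x)).
Qed.

(** Multilinearity: a tensor product of mixtures is a mixture over words with product weights. It
    serves both i.i.d. inputs and i.i.d. channel states. *)
Lemma tens_mix (S : finType) (c : 'I_l -> S -> R) (A : 'I_l -> S -> 'M[C]_d) :
  q_tens (fun i => \sum_s (c i s)%:C%C *: A i s) =
  \sum_(s : {ffun 'I_l -> S}) (prodw c s)%:C%C *: q_tens (fun i => A i (s i)).
Proof.
apply/matrixP => i j; rewrite tensE summxE.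
under eq_bigr do rewrite summxE.
rewrite bigA_distr_bigA; apply: eq_bigr => s _; rewrite mxE tensE rmorph_prod -big_split /=.
by apply: eq_bigr => k _; rewrite mxE.
Qed.

Lemma tens_dg V (r : 'I_l -> 'I_d -> R) :
  q_tens (fun i => dg (V i) (r i)) = dg (q_tens V) (fun k => prodw r (wd k)).
Proof.
rewrite /dg tens_dag -!tensM; apply: conj_congr.
apply/matrixP => i j; rewrite tensE !mxE.
case: eqVneq => [->|ij].
  by rewrite mulr1n rmorph_prod; apply: eq_bigr => k _; rewrite !mxE eqxx mulr1n.
have : exists k, wd i k != wd j k.
  apply/existsP; rewrite -negb_forall; apply: contra ij => /forallP h.
  by apply/eqP/wd_inj/ffunP => k; apply/eqP.
by case=> k hk; rewrite mulr0n (bigD1 k) //= !mxE (negPf hk) mulr0n mul0r.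
Qed.

(** A product state measured in a product basis has independent outcomes, so Chernoff's bound
    applies to them. *)
Lemma outp_tens V rho k : (forall i, q_psd (rho i)) ->
  outp (q_tens V) (q_tens rho) k = prodw (fun i => outp (V i) (rho i)) (wd k).
Proof.
move=> h; rewrite /outp tens_dag !tensM tensE Re_prod_ge0 // => i.
exact: psd_congr_diag.
Qed.

Lemma overlap_tens U V a b :
  overlap (q_tens U) (q_tens V) a b = \prod_i overlap (U i) (V i) (wd a i) (wd b i).
Proof. by rewrite /overlap tens_dag tensM tensE nsq_prod. Qed.

Lemma tens_psd rho : (forall i, q_psd (rho i)) -> q_psd (q_tens rho).
Proof.
move=> h; have h' i := psd_spectral (h i).
have [V hV] := choice h'; have [r hr] := choice hV.
rewrite (tens_ext (g := fun i => dg (V i) (r i))) => [|i]; last by case: (hr i).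
rewrite tens_dg; apply: psd_dg => k; apply: prodr_ge0 => i _.
by case: (hr i).
Qed.

Lemma tens_state rho : (forall i, q_is_state (rho i)) -> q_is_state (q_tens rho).
Proof.
move=> h; split; first by apply: tens_psd => i; case: (h i).
by rewrite tens_tr big1 // => i _; case: (h i).
Qed.

End Tensor.

Lemma mix_state {R : realType} n (I : finType) (q : I -> R) (A : I -> 'M[R[i]]_n) :
  q_pdist q -> (forall i, q_is_state (A i)) ->
  q_is_state (\sum_i (q i)%:C%C *: A i).
Proof.
move=> [q0 q1] h; split.
  by apply: psd_sum => i _; apply: psdZ => //; case: (h i).
rewrite raddf_sum /= (eq_bigr (fun i => (q i)%:C%C)) => [|i _].
  by rewrite -rmorph_sum /= q1.
by rewrite linearZ /=; case: (h i) => _ ->; rewrite mulr1.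
Qed.

(** * Entropy *)

Section Entropy.
Context {R : realType}.
Local Notation C := R[i].
Local Notation Re := (@complex.Re R).

Lemma char_poly_dg n (V : 'M[C]_n) r : V \is unitarymx ->
  char_poly (dg V r) = \prod_(j < n) ('X - ((r j)%:C%C)%:P).
Proof.
move=> Vu; set D := diag_mx (\row_j (r j)%:C%C).
transitivity (char_poly D).
  rewrite /char_poly /char_poly_mx.
  set pV := map_mx polyC V; set pVt := map_mx polyC (V^t*).
  have VtV : pVt *m pV = 1%:M.
    by rewrite -map_mxM -invmx_unitary // mulVmx ?unitarymx_unit // map_mx1.
  have -> : 'X%:M - map_mx polyC (dg V r) = pVt *m ('X%:M - map_mx polyC D) *m pV.
    rewrite mulmxBr mulmxBl -scalemx1 -scalemxAr -scalemxAl mulmx1 VtV.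
    by rewrite /dg -!map_mxM.
  by rewrite !det_mulmx mulrAC -det_mulmx VtV det1 mul1r.
rewrite char_poly_trig; last exact/is_diag_mx_is_trig/diag_mx_is_diag.
by apply: eq_bigr => j _; rewrite !mxE eqxx mulr1n.
Qed.

(** [q_eigs] is only some root list of the characteristic polynomial, but unique factorization
    determines it up to a permutation, which the sum does not see. *)
Lemma entropy_dg n (V : 'M[C]_n) r : V \is unitarymx ->
  q_entropy (dg V r) = - \sum_j r j * q_log2 (r j).
Proof.
move=> Vu; rewrite /q_entropy; congr (- _).
pose s := [seq (r j)%:C%C | j <- enum 'I_n].
have hs : char_poly (dg V r) = \prod_(z <- s) ('X - z%:P).
  by rewrite char_poly_dg // big_map big_enum.
have he : char_poly (dg V r) = \prod_(z <- q_eigs (dg V r)) ('X - z%:P).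
  exact: (@xgetPex _ [::] [set s | char_poly (dg V r) = \prod_(z <- s) ('X - z%:P)]%classic (ex_intro _ s hs)).
have hp : perm_eq (q_eigs (dg V r)) s.
  by apply: prod_XsubC_eq; rewrite -he hs.
by rewrite (perm_big _ hp) big_map big_enum.
Qed.

(** This is [ln z <= z - 1] at [z = y / x], with [0 ln 0 = 0]; summed over two laws it gives Gibbs'
    inequality. *)
Lemma gibbs_term (x y : R) : 0 <= x -> 0 < y -> x * ln y - x * ln x <= y - x.
Proof.
move=> x0 y0; have [->|xn0] := eqVneq x 0; first by rewrite !mul0r subrr subr0 ltW.
have xp : 0 < x by rewrite lt_def xn0.
rewrite -mulrBr -ln_div ?posrE // -ler_pdivlMl // mulrBr mulVf // [x^-1 * y]mulrC.
have := @le_ln1Dx R (y / x - 1).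
rewrite (_ : 1 + (y / x - 1) = y / x); last by rewrite addrC subrK.
by apply; rewrite ltrBrDr addrC subrr divr_gt0.
Qed.

Lemma ln2_gt0 : 0 < ln 2 :> R.
Proof. by rewrite ln_gt0 // ltr1n. Qed.

Lemma entropy_nat n (V : 'M[C]_n) r : V \is unitarymx ->
  ln 2 * q_entropy (dg V r) = - \sum_j r j * ln (r j).
Proof.
move=> Vu; rewrite entropy_dg // mulrN mulr_sumr; congr (- _); apply: eq_bigr => j _.
by rewrite /q_log2 mulrCA [ln 2 * _]mulrC divfK // gt_eqF // ln2_gt0.
Qed.

Lemma state_spectral n (rho : 'M[C]_n) : q_is_state rho ->
  exists V r, [/\ V \is unitarymx, q_pdist r & rho = dg V r].
Proof.
case=> /psd_spectral[V [r [Vu r0 ->]]] h; exists V, r; split=> //; split=> //.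
rewrite -(outp_sum1 Vu h); apply: eq_bigr => j _; by rewrite outp_dg.
Qed.
End Entropy.

(** * Typical tests *)

Section Smoothing.
Context {R : realType}.
Variables (d : nat) (k : R).
Hypotheses (k_gt0 : 0 < k) (k_lt1 : k < 1).

(** The spectrum after mixing with the maximally mixed state. Its floor [k / d] keeps logarithms
    bounded, as Chernoff's bound requires. *)
Definition smooth (r : 'I_d -> R) (j : 'I_d) : R := (1 - k) * r j + k / d%:R.
Definition smooth_log_bound : R := - ln (k / d%:R).

Lemma pdist_le1 (T : finType) (r : T -> R) j : q_pdist r -> r j <= 1.
Proof.
by case=> r0 <-; rewrite (bigD1 j) //= lerDl sumr_ge0.
Qed.

Lemma pdist_ord_gt0 n (r : 'I_n -> R) : q_pdist r -> (0 < n)%N.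
Proof. by case: n r => // r [_]; rewrite big_ord0 => /eqP; rewrite eq_sym oner_eq0. Qed.

Let d_gt0 (j : 'I_d) : 0 < d%:R :> R.
Proof. by rewrite ltr0n; case: j => j; apply: leq_ltn_trans. Qed.

Lemma smooth_ge r j : 0 <= r j -> k / d%:R <= smooth r j.
Proof. by move=> r0; rewrite lerDr mulr_ge0 // subr_ge0 ltW. Qed.

Lemma smooth_floor_gt0 (j : 'I_d) : 0 < k / d%:R.
Proof. by rewrite divr_gt0 // d_gt0. Qed.

Lemma smooth_gt0 r j : 0 <= r j -> 0 < smooth r j.
Proof. by move=> r0; apply: lt_le_trans (smooth_ge r0); exact: smooth_floor_gt0. Qed.

Lemma smooth_le1 r j : q_pdist r -> smooth r j <= 1.
Proof.
move=> hr; have r1 := pdist_le1 j hr; rewrite /smooth.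
have : k / d%:R <= k.
  rewrite ler_pdivrMr ?d_gt0 // ler_peMr ?(ltW k_gt0) // ler1n.
  by case: j {r1} => j; apply: leq_ltn_trans.
have : (1 - k) * r j <= 1 - k by rewrite ler_piMr // subr_ge0 ltW.
lra.
Qed.

Lemma smooth_log_le r j : q_pdist r -> `|ln (smooth r j)| <= smooth_log_bound.
Proof.
move=> hr; have [r0 _] := hr.
rewrite ler0_norm ?ln_le0 ?smooth_le1 // lerN2 ler_ln ?posrE ?smooth_gt0 ?smooth_ge //.
exact: smooth_floor_gt0.
Qed.

Lemma smooth_log_bound_ge0 (j : 'I_d) (r : 'I_d -> R) : q_pdist r -> 0 <= smooth_log_bound.
Proof. by move=> hr; apply: le_trans (smooth_log_le j hr). Qed.

Lemma smooth_sum r : q_pdist r -> \sum_j smooth r j = 1.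
Proof.
move=> hr; have dp := pdist_ord_gt0 hr; case: hr => [r0 r1].
rewrite big_split /= -mulr_sumr r1 sumr_const card_ord -[_ *+ _]mulr_natr.
by rewrite divfK ?mulr1 ?subrK // pnatr_eq0 -lt0n.
Qed.

Lemma dg_smooth (V : 'M[R[i]]_d) r : V \is unitarymx ->
  dg V (smooth r) = (1 - k)%:C%C *: dg V r + (k / d%:R)%:C%C *: 1%:M.
Proof.
by move=> Vu; rewrite -(dg1 Vu) !dgZ dgD; apply: dg_ext => j; rewrite mulr1.
Qed.
End Smoothing.

Section Indicator.
Context {R : realType}.
Variables (n : nat) (V : 'M[R[i]]_n) (b : pred 'I_n).
Hypothesis Vu : V \is unitarymx.

Definition ind_proj := dg V (fun k => (b k)%:R : R).

Lemma ind_proj_psd : q_psd ind_proj.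
Proof. by apply: psd_dg => j; rewrite ler0n. Qed.

Lemma ind_projC : 1%:M - ind_proj = dg V (fun k => (~~ b k)%:R : R).
Proof. by rewrite -(dg1 Vu) dgB; apply: dg_ext => j; case: (b j); rewrite ?subrr ?subr0. Qed.

Lemma ind_projC_psd : q_psd (1%:M - ind_proj).
Proof. by rewrite ind_projC; apply: psd_dg => j; rewrite ler0n. Qed.

Lemma ind_proj_herm : ind_proj^t* = ind_proj.
Proof. exact: psd_herm ind_proj_psd. Qed.

Lemma ind_proj_idem : ind_proj *m ind_proj = ind_proj.
Proof. by rewrite (dgM _ _ Vu); apply: dg_ext => j; case: (b j); rewrite ?mulr1 ?mulr0. Qed.

Lemma ev_ind_projC (rho : 'M[R[i]]_n) :
  ev rho (1%:M - ind_proj) = \sum_(k | ~~ b k) outp V rho k.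
Proof.
rewrite ind_projC ev_dgr [RHS]big_mkcond; apply: eq_bigr => k _.
by case: (b k); rewrite ?mul0r ?mul1r.
Qed.
End Indicator.

Lemma mean_const {R : realType} (T : finType) (q : T -> R) c :
  q_pdist q -> c = \sum_t q t * c.
Proof. by case=> _ q1; rewrite -mulr_suml q1 mul1r. Qed.

Lemma prodw_expR {R : realType} (I Y : finType) (w : I -> Y -> R) f :
  (forall i y, 0 < w i y) -> prodw w f = expR (\sum_i ln (w i (f i))).
Proof.
by move=> h; rewrite expR_sum; apply: eq_bigr => i _; rewrite lnK // posrE.
Qed.

(** Zips two words into one word of pairs, so that a joint law becomes a single product measure. *)
Lemma sum_pair_words {R : realType} (l : nat) (X Y : finType)
    (F : {ffun 'I_l -> X} -> {ffun 'I_l -> Y} -> R) :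
  \sum_x \sum_y F x y =
  \sum_(z : {ffun 'I_l -> X * Y}) F [ffun i => (z i).1] [ffun i => (z i).2].
Proof.
rewrite pair_bigA /=.
rewrite (reindex (fun z : {ffun 'I_l -> X * Y} => ([ffun i => (z i).1], [ffun i => (z i).2]))) //=.
exists (fun u : {ffun 'I_l -> X} * {ffun 'I_l -> Y} => [ffun i => (u.1 i, u.2 i)]).
  by move=> z _; apply/ffunP => i; rewrite !ffunE /=; case: (z i).
by case=> u v _ /=; congr (_, _); apply/ffunP => i; rewrite !ffunE.
Qed.

Section TypicalTests.
Context {R : realType}.
Local Notation C := R[i].
Variables (d l : nat) (X : finType) (p : X -> R) (W : X -> 'M[C]_d) (k dl : R).
Hypotheses (p_pdist : q_pdist p) (k_gt0 : 0 < k) (k_lt1 : k < 1) (dl_gt0 : 0 < dl).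
Variables (Vx : X -> 'M[C]_d) (rx : X -> 'I_d -> R) (V : 'M[C]_d) (r : 'I_d -> R).
Hypotheses (Vxu : forall x, Vx x \is unitarymx) (rx_pdist : forall x, q_pdist (rx x)).
Hypotheses (Wx : forall x, W x = dg (Vx x) (rx x)).
Hypotheses (Vu : V \is unitarymx) (r_pdist : q_pdist r).
Hypotheses (Wp : \sum_x (p x)%:C%C *: W x = dg V r).
Local Notation xword := {ffun 'I_l -> X}.
Local Notation bound := (smooth_log_bound d k).

(** Log-eigenvalues of the smoothed mean output and, in [typ_Zx], of the smoothed outputs. Their
    means [typ_a] and [typ_b] approximate minus the entropy of the mean output and minus the mean
    output entropy, so [typ_b - typ_a] approximates the Holevo information in nats. *)
Definition typ_Z j := ln (smooth k r j).
Definition typ_Zx x j := ln (smooth k (rx x) j).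
Definition typ_a := \sum_j r j * typ_Z j.
Definition typ_b := \sum_x p x * \sum_j rx x j * typ_Zx x j.
(** Typicality is one-sided: [typ_inP] bounds a product eigenvalue from above, [typ_inQ] bounds one
    from below. *)
Definition typ_inP (m : 'I_(q_tdim d l)) := \sum_i typ_Z (wd m i) <= l%:R * (typ_a + dl).
Definition typ_inQ (x : {ffun 'I_l -> X}) (m : 'I_(q_tdim d l)) :=
  l%:R * (typ_b - dl) <= \sum_i typ_Zx (x i) (wd m i).
Definition typ_P := ind_proj (q_tens (fun _ : 'I_l => V)) typ_inP.
Definition typ_Q (x : xword) := ind_proj (q_tens (fun i : 'I_l => Vx (x i))) (typ_inQ x).
Definition typ_E (x : xword) := typ_P *m typ_Q x *m typ_P.

Let Vlu : q_tens (fun _ : 'I_l => V) \is unitarymx.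
Proof. exact: (tens_unitary (fun=> Vu)). Qed.
Let Vxlu (x : xword) : q_tens (fun i : 'I_l => Vx (x i)) \is unitarymx.
Proof. exact: (tens_unitary (fun i => Vxu (x i))). Qed.

Lemma typ_E_psd x : q_psd (typ_E x).
Proof. exact: (sandwich_psd (ind_proj_herm _ _) (ind_proj_psd _ _)). Qed.

Lemma typ_E_le1 x : q_psd (1%:M - typ_E x).
Proof.
exact: (sandwich_le1 (ind_proj_herm _ _) (ind_proj_idem _ Vlu) (ind_projC_psd _ (Vxlu x))).
Qed.

(* Conditionally typical projections are dominated by the output states, which
   average to the l-fold product of the mean output state, and that is small on
   the range of typ_P. *)
Lemma typ_E_avg :
  q_psd ((expR (l%:R * (typ_a - typ_b + 2 * dl)))%:C%C *: 1%:M -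
         \sum_(x : xword) (prodw (fun=> p) x)%:C%C *: typ_E x).
Proof.
pose c1 := expR (- (l%:R * (typ_b - dl))); pose c2 := expR (l%:R * (typ_a + dl)).
have -> : expR (l%:R * (typ_a - typ_b + 2 * dl)) = c1 * c2.
  by rewrite /c1 /c2 -expRD; congr expR; ring.
pose rho' (x : xword) := dg (q_tens (fun i : 'I_l => Vx (x i)))
  (fun m => prodw (fun i => smooth k (rx (x i))) (wd m)).
pose sg := dg (q_tens (fun _ : 'I_l => V)) (fun m => prodw (fun=> smooth k r) (wd m)).
(* Smoothing is affine with the same [k] for every letter, so it commutes with averaging over
   [p]. *)
have sgE : \sum_(x : xword) (prodw (fun=> p) x)%:C%C *: rho' x = sg.
  pose W' (_ : 'I_l) x := dg (Vx x) (smooth k (rx x)).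
  transitivity (\sum_(x : xword) (prodw (fun=> p) x)%:C%C *: q_tens (fun i => W' i (x i))).
    by apply: eq_bigr => x _; rewrite /W' tens_dg.
  rewrite -tens_mix /sg -tens_dg; apply: tens_ext => i; rewrite /W'.
  under eq_bigr do rewrite (dg_smooth _ _ (Vxu _)) -Wx scalerDr !scalerA.
  rewrite (dg_smooth _ _ Vu) big_split /= -Wp scaler_sumr; congr (_ + _).
    by apply: eq_bigr => x _; rewrite scalerA mulrC.
  by rewrite -scaler_suml -mulr_suml -rmorph_sum; case: p_pdist => _ ->; rewrite mul1r.
have h1 : q_psd (c2%:C%C *: 1%:M - typ_P *m sg *m typ_P).
  rewrite -(dg1 Vlu) dgZ !(dgM _ _ Vlu) dgB; apply: psd_dg => m; rewrite mulr1 subr_ge0.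
  case hm : (typ_inP m); last by rewrite !mul0r expR_ge0.
  rewrite mul1r mulr1 prodw_expR => [|i y]; first by rewrite ler_expR.
  by apply: smooth_gt0 => //; case: r_pdist.
have h2 (x : xword) : q_psd (c1%:C%C *: rho' x - typ_Q x).
  rewrite dgZ dgB; apply: psd_dg => m; rewrite subr_ge0.
  rewrite prodw_expR => [|i y]; last by apply: smooth_gt0 => //; case: (rx_pdist (x i)).
  rewrite -expRD; case hm : (typ_inQ x m); last exact: expR_ge0.
  by rewrite -[leLHS]expR0 ler_expR addrC subr_ge0.
have -> : (c1 * c2)%:C%C *: 1%:M - \sum_(x : xword) (prodw (fun=> p) x)%:C%C *: typ_E x =
    c1%:C%C *: (c2%:C%C *: 1%:M - typ_P *m sg *m typ_P) +
    typ_P *m (\sum_(x : xword) (prodw (fun=> p) x)%:C%C *: (c1%:C%C *: rho' x - typ_Q x)) *m typ_P.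
  have -> : \sum_(x : xword) (prodw (fun=> p) x)%:C%C *: (c1%:C%C *: rho' x - typ_Q x) =
      c1%:C%C *: sg - \sum_(x : xword) (prodw (fun=> p) x)%:C%C *: typ_Q x.
    rewrite -sgE scaler_sumr -sumrB; apply: eq_bigr => x _.
    by rewrite scalerBr !scalerA mulrC.
  rewrite scalerBr scalerA -rmorphM mulmxBr mulmxBl -scalemxAr -scalemxAl addrA subrK.
  congr (_ - _); rewrite mulmx_sumr mulmx_suml; apply: eq_bigr => x _.
  by rewrite -scalemxAr -scalemxAl.
apply: psdD; first by apply: psdZ h1; exact: expR_ge0.
apply: (psd_conj_herm (ind_proj_herm _ _)); apply: psd_sum => x _; apply: psdZ (h2 x).
by apply: prodw_ge0 => i y; case: p_pdist.
Qed.

(** Gibbs' inequality bounds [typ_a] without loss, and [smooth k r >= (1 - k) r] bounds [typ_b] up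
    to [ln (1 - k)], the whole price of smoothing. *)
Lemma typ_rate : typ_a - typ_b <= - (ln 2 * q_holevo p W) - ln (1 - k).
Proof.
have [p0 p1] := p_pdist; have [r0 r1] := r_pdist.
have ha : typ_a <= \sum_j r j * ln (r j).
  rewrite -subr_le0 -sumrB.
  apply: (@le_trans _ _ (\sum_j (smooth k r j - r j))); last first.
    by rewrite sumrB smooth_sum // r1 subrr.
  by apply: ler_sum => j _; apply: gibbs_term => //; apply: smooth_gt0.
have hb : \sum_x p x * (\sum_j rx x j * ln (rx x j)) + ln (1 - k) <= typ_b.
  rewrite [X in _ + X](mean_const _ p_pdist) -big_split /=; apply: ler_sum => x _.
  have [rx0 rx1] := rx_pdist x.
  rewrite -mulrDr ler_wpM2l // [X in _ + X](mean_const _ (rx_pdist x)) -big_split /=.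
  apply: ler_sum => j _; rewrite -mulrDr.
  have [->|rn0] := eqVneq (rx x j) 0; first by rewrite !mul0r.
  have rp : 0 < rx x j by rewrite lt_def rn0 rx0.
  have k1 : 0 < 1 - k by rewrite subr_gt0.
  apply: ler_wpM2l => //; rewrite [leLHS]addrC.
  have <- : ln ((1 - k) * rx x j) = ln (1 - k) + ln (rx x j) by apply: lnM.
  rewrite ler_ln ?posrE ?mulr_gt0 ?smooth_gt0 //.
  by rewrite lerDl ltW // smooth_floor_gt0.
have -> : ln 2 * q_holevo p W = - \sum_j r j * ln (r j) + \sum_x p x * (\sum_j rx x j * ln (rx x j)).
  rewrite /q_holevo mulrBr Wp (entropy_nat _ Vu); congr (_ + _); rewrite mulr_sumr -sumrN.
  apply: eq_bigr => x _; rewrite mulrCA Wx (entropy_nat _ (Vxu x)); ring.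
lra.
Qed.

(** The tests are built from [W], yet the letters [rho i] may vary with the position: the Chernoff
    means are linear in the state, so only the sum over positions matters. The 5 is the [3 + 2] of
    [ev_sandwich]. *)
Lemma typ_E_miss (rho : 'I_l -> X -> 'M[C]_d) :
  (forall i x, q_is_state (rho i x)) ->
  (forall x, \sum_i rho i x = (l%:R : R)%:C%C *: W x) ->
  \sum_(x : xword) prodw (fun=> p) x * ev (q_tens (fun i => rho i (x i))) (1%:M - typ_E x)
  <= 5 * expR (- (l%:R * chernoff_exp bound dl)).
Proof.
move=> hrho hsum; have [p0 p1] := p_pdist; have [r0 r1] := r_pdist.
set e := expR _.
pose rb i := \sum_x (p x)%:C%C *: rho i x.
have hrb i : q_is_state (rb i) by apply: mix_state.
have rpsd i x : q_psd (rho i x) by case: (hrho i x).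
have dp := pdist_ord_gt0 r_pdist.
have B0 : 0 <= bound by apply: (smooth_log_bound_ge0 k_gt0 k_lt1 (Ordinal dp) r_pdist).
have hP : \sum_(x : xword) prodw (fun=> p) x *
    ev (q_tens (fun i => rho i (x i))) (1%:M - typ_P) <= e.
  apply: (@le_trans _ _ (ev (q_tens rb) (1%:M - typ_P))).
    rewrite /rb tens_mix ev_suml le_eqVlt; apply/orP; left; apply/eqP.
    by apply: eq_bigr => x _; rewrite evZl.
  rewrite (ev_ind_projC _ Vlu) big_mkcond /=.
  pose G (w : {ffun 'I_l -> 'I_d}) := if ~~ (\sum_i typ_Z (w i) <= l%:R * (typ_a + dl))
      then prodw (fun i => outp V (rb i)) w else 0.
  rewrite (eq_bigr (fun m => G (wd m))) => [|m _]; last first.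
    by rewrite outp_tens // => i; case: (hrb i).
  rewrite sum_wd -big_mkcond.
  have ch := @chernoff_tail R 'I_d l (fun i => outp V (rb i)) (fun=> typ_Z) bound dl B0 dl_gt0.
  apply: le_trans (ch _ _); last 2 first.
  - move=> i; split=> [j|]; first by apply: outp_ge0; case: (hrb i).
    by apply: outp_sum1 => //; case: (hrb i).
  - by move=> i y; apply: smooth_log_le.
  (* The means at single positions may differ from [typ_a]; [hsum] fixes their sum. *)
  have -> : \sum_(i < l) \sum_j outp V (rb i) j * typ_Z j = l%:R * typ_a.
    rewrite exchange_big mulr_sumr; apply: eq_bigr => j _ /=.
    rewrite -mulr_suml mulrA; congr (_ * _).
    have -> : \sum_(i < l) outp V (rb i) j = \sum_x p x * \sum_i outp V (rho i x) j.
      rewrite (eq_bigr (fun i => \sum_x p x * outp V (rho i x) j)) => [|i _]; last exact: outp_suml.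
      by rewrite exchange_big; apply: eq_bigr => x _; rewrite mulr_sumr.
    transitivity (l%:R * outp V (dg V r) j); last by rewrite outp_dg.
    rewrite -Wp outp_suml mulr_sumr; apply: eq_bigr => x _; rewrite mulrCA; congr (_ * _).
    by rewrite -outpZ -hsum outp_sum.
  rewrite [leLHS]big_mkcond [leRHS]big_mkcond; apply: ler_sum => w _.
  rewrite -ltNge; case: ifPn => [h|_].
    by rewrite -mulrDr (ltW h).
  by case: ifP => // _; apply: prodw_ge0 => i y; apply: outp_ge0; case: (hrb i).
have hQ : \sum_(x : xword) prodw (fun=> p) x *
    ev (q_tens (fun i => rho i (x i))) (1%:M - typ_Q x) <= e.
  (* The law of the pair (input letter, outcome in the eigenbasis of that letter); the pairs are
     independent over positions. The sign in [Zm] turns the lower tail into an upper one. *)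
  pose w i (z : X * 'I_d) := p z.1 * outp (Vx z.1) (rho i z.1) z.2.
  pose Zm (_ : 'I_l) (z : X * 'I_d) := - typ_Zx z.1 z.2.
  have hw i : q_pdist (w i).
    split=> [z|]; first by rewrite mulr_ge0 // outp_ge0.
    rewrite -(pair_bigA _ (fun x j => p x * outp (Vx x) (rho i x) j)) /= -p1.
    by apply: eq_bigr => x _; rewrite -mulr_sumr outp_sum1 ?mulr1 //; case: (hrho i x).
  have hZ i z : `|Zm i z| <= bound by rewrite normrN; apply: smooth_log_le.
  apply: le_trans (chernoff_tail B0 dl_gt0 hw hZ).
  have -> : \sum_i \sum_z w i z * Zm i z = - (l%:R * typ_b).
    rewrite (eq_bigr (fun i => \sum_x \sum_j w i (x, j) * Zm i (x, j))) => [|i _]; last first.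
      by rewrite (pair_bigA _ (fun x j => w i (x, j) * Zm i (x, j))); apply: eq_bigr => -[].
    rewrite exchange_big /= mulr_sumr -sumrN; apply: eq_bigr => x _.
    rewrite exchange_big /= !mulr_sumr -sumrN; apply: eq_bigr => j _.
    rewrite /w /Zm /=; under eq_bigr do rewrite mulrN.
    rewrite sumrN -mulr_suml -mulr_sumr -outp_sum hsum outpZ Wx (outp_dg _ _ (Vxu x)).
    by congr (- _); rewrite mulrCA !mulrA.
  rewrite (eq_bigr (fun x : xword => \sum_(v : {ffun 'I_l -> 'I_d})
      if ~~ (l%:R * (typ_b - dl) <= \sum_i typ_Zx (x i) (v i)) then
        prodw w [ffun i => (x i, v i)] else 0)); last first.
    move=> x _; rewrite (ev_ind_projC _ (Vxlu x)) big_mkcond /= mulr_sumr.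
    rewrite -sum_wd; apply: eq_bigr => m _; rewrite /typ_inQ; case: ifP => _; last by rewrite mulr0.
    rewrite outp_tens // -big_split /=.
    by apply: eq_bigr => i _; rewrite ffunE.
  rewrite sum_pair_words [leRHS]big_mkcond; apply: ler_sum => z _ /=.
  have -> : [ffun i => ([ffun i0 => (z i0).1] i, [ffun i0 => (z i0).2] i)] = z.
    by apply/ffunP => i; rewrite !ffunE; case: (z i).
  under eq_bigr do rewrite !ffunE.
  rewrite -ltNge; case: ifPn => [h|_].
    rewrite ifT // /Zm sumrN; move: h; lra.
  by case: ifP => // _; apply: prodw_ge0 => i y; case: (hw i).
have -> : 5 * e = 3 * e + 2 * e by rewrite -mulrDl -natrD.
apply: le_trans (lerD (ler_wpM2l _ hP) (ler_wpM2l _ hQ)) => //.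
rewrite !mulr_sumr -big_split; apply: ler_sum => x _ /=.
rewrite ![_ * (prodw _ _ * _)]mulrCA -mulrDr ler_wpM2l //; first by apply: prodw_ge0.
have hs := tens_psd (fun i => rpsd i (x i)).
exact: (ev_sandwich (ind_proj_herm _ typ_inP) (ind_proj_idem typ_inP Vlu)
          (ind_proj_psd _ (typ_inQ x)) (ind_projC_psd (typ_inQ x) (Vxlu x)) hs).
Qed.
End TypicalTests.

(** * Random coding *)

(** Hides the eigenbases and expresses the size of the tests by [q_holevo]. The tests are chosen
    before [rho], hence serve every varying product whose letters average to [W]. *)
Lemma exists_tests {R : realType} (d l : nat) (X : finType) (p : X -> R)
    (W : X -> 'M[R[i]]_d) (k dl : R) :
  q_pdist p -> (forall x, q_is_state (W x)) -> 0 < k -> k < 1 -> 0 < dl ->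
  exists E : {ffun 'I_l -> X} -> 'M[R[i]]_(q_tdim d l),
  [/\ forall x, q_psd (E x), forall x, q_psd (1%:M - E x),
      q_psd ((expR (- (l%:R * (ln 2 * q_holevo p W + ln (1 - k) - 2 * dl))))%:C%C *: 1%:M -
         \sum_x (prodw (fun=> p) x)%:C%C *: E x) &
      forall rho : 'I_l -> X -> 'M[R[i]]_d,
        (forall i x, q_is_state (rho i x)) ->
        (forall x, \sum_i rho i x = (l%:R : R)%:C%C *: W x) ->
        \sum_x prodw (fun=> p) x * ev (q_tens (fun i => rho i (x i))) (1%:M - E x)
          <= 5 * expR (- (l%:R * chernoff_exp (smooth_log_bound d k) dl))].
Proof.
move=> hp hW k0 k1 dl0.
have [Vx hVx] := choice (fun x => state_spectral (hW x)).
have [rx hrx] := choice hVx.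
have [V [r [Vu hr Wp]]] := state_spectral (mix_state hp hW).
have Vxu x : Vx x \is unitarymx by case: (hrx x).
have rxp x : q_pdist (rx x) by case: (hrx x).
have Wx x : W x = dg (Vx x) (rx x) by case: (hrx x).
exists (@typ_E R d l X p k dl Vx rx V r); split.
- by move=> x; apply: typ_E_psd.
- by move=> x; apply: typ_E_le1.
- have h := @typ_E_avg R d l X p W k dl hp k0 k1 Vx rx V r Vxu rxp Wx Vu hr Wp.
  have rate := typ_rate hp k0 k1 Vxu rxp Wx Vu hr Wp.
  set B := _%:C%C *: 1%:M in h; set B' := _%:C%C *: 1%:M.
  have hB : q_psd (B' - B).
    rewrite /B /B' -scalerBl -rmorphB; apply: psdZ; last exact: psd1.
    rewrite subr_ge0 ler_expR -mulrN ler_wpM2l //; move: rate; lra.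
  by have := psdD hB h; rewrite addrA subrK.
- by move=> rho; apply: typ_E_miss.
Qed.

Section RandomCoding.
Context {R : realType}.
Local Notation C := R[i].
Variables (n M : nat) (T Y : finType) (w : Y -> R) (rho : Y -> 'M[C]_n).
Variables (E : T -> Y -> 'M[C]_n) (t0 : T) (c beta miss : R).
Hypotheses (w_pdist : q_pdist w) (rho_state : forall y, q_is_state (rho y)).
Hypotheses (E_psd : forall t y, q_psd (E t y)) (E_le1 : forall t y, q_psd (1%:M - E t y)).
Hypotheses (E_avg : forall t, q_psd (beta%:C%C *: 1%:M - \sum_y (w y)%:C%C *: E t y)).
Hypotheses (E_miss : \sum_y w y * ev (rho y) (1%:M - E t0 y) <= miss).
Hypotheses (beta_ge0 : 0 <= beta) (c_gt0 : 0 < c) (M_gt0 : (0 < M)%N).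

(** The decoder does not know which [t] is in force, so each message is tested by the sum over all
    [t], at the cost of a factor [#|T|] in false alarms. *)
Definition book_decoder (f : {ffun 'I_M -> Y}) : 'I_M -> 'M[C]_n :=
  inc_decoder (fun m => \sum_t E t (f m)) c.

Lemma book_decoder_valid f : q_decoder_valid (book_decoder f).
Proof. by apply: inc_decoder_valid => // m; apply: psd_sum => t _; exact: E_psd. Qed.

(** The three terms are: the miss of the relevant test [t0]; the defect of the resolvent; and the
    false alarms, where an earlier codeword is independent of the sent one, so each of its [#|T|]
    tests is passed with mean probability at most [beta]. *)
Lemma random_coding :
  \sum_(f : {ffun 'I_M -> Y}) prodw (fun=> w) f *
     ((M%:R)^-1 * \sum_m ev (rho (f m)) (1%:M - book_decoder f m))
  <= miss + (1 + c)^-1 + c * M%:R * #|T|%:R * beta.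
Proof.
have [w0 w1] := w_pdist.
have w1' (i : 'I_M) : \sum_y w y = 1 by [].
pose A y := \sum_t E t y.
have A_avg y : \sum_z w z * ev (rho y) (A z) <= #|T|%:R * beta.
  under eq_bigr do rewrite /A ev_sumr mulr_sumr.
  rewrite exchange_big /=; apply: (@le_trans _ _ (\sum_(t : T) beta)); last first.
    by rewrite sumr_const mulr_natl.
  apply: ler_sum => t _; have [rp _] := rho_state y.
  have := ev_ge0 rp (E_avg t); rewrite evBr evZr (ev_state1 (rho_state y)) mulr1 subr_ge0.
  by rewrite ev_sumr; apply: le_trans; apply: ler_sum => z _; rewrite evZr.
set K := miss + _ + _.
have hm (m : 'I_M) : \sum_(f : {ffun 'I_M -> Y}) prodw (fun=> w) f *
    ev (rho (f m)) (1%:M - book_decoder f m) <= K.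
  pose h f := ev (rho (f m)) (1%:M - E t0 (f m)) + (1 + c)^-1 +
    c * \sum_(i < M | (i < m)%N) ev (rho (f m)) (A (f i)).
  apply: (@le_trans _ _ (\sum_(f : {ffun 'I_M -> Y}) prodw (fun=> w) f * h f)).
    apply: ler_sum => f _; apply: ler_wpM2l; first exact: prodw_ge0.
    apply: (inc_decoder_err (A := fun m => A (f m))).
    - by move=> i; apply: psd_sum => t _; apply: E_psd.
    - exact: c_gt0.
    - exact: rho_state.
    - exact: E_psd.
    - exact: E_le1.
    - rewrite /A (bigD1 t0) //= addrAC subrr add0r; apply: psd_sum => t _; exact: E_psd.
  rewrite /h; under eq_bigr do rewrite 2!mulrDr mulrCA mulr_sumr.
  rewrite !big_split /=; apply: lerD; first apply: lerD.
  - rewrite (prodw_marginal w1' m (fun y => ev (rho y) (1%:M - E t0 y))); exact: E_miss.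
  - by rewrite -mulr_suml (prodw_sum1 w1') mul1r.
  - rewrite -mulr_sumr -!mulrA; apply: ler_wpM2l; first exact: ltW.
    rewrite exchange_big /=.
    apply: (@le_trans _ _ (\sum_(i < M) #|T|%:R * beta)); last first.
      by rewrite sumr_const card_ord [leRHS]mulr_natl.
    rewrite big_mkcond; apply: ler_sum => i _; case: ifP => im; last by rewrite mulr_ge0.
    have mi : m != i by rewrite neq_ltn im orbT.
    rewrite (prodw_marginal2 w1' (fun y z => ev (rho y) (A z)) mi).
    rewrite [leRHS](mean_const _ w_pdist); apply: ler_sum => y _.
    under eq_bigr do rewrite -mulrA.
    by rewrite -mulr_sumr; apply: ler_wpM2l.
under eq_bigr do rewrite mulrCA mulr_sumr.
rewrite -mulr_sumr exchange_big /= mulrC ler_pdivrMr ?ltr0n //.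
apply: (@le_trans _ _ (\sum_(m < M) K)); first by apply: ler_sum => m _; apply: hm.
by rewrite sumr_const card_ord mulr_natr.
Qed.
End RandomCoding.

(** * Types and codes for the varying channel *)

Section Types.
Context {R : realType}.
Variables (S : finType) (l : nat).
Hypothesis l_gt0 : (0 < l)%N.

Definition count_of (s : 'I_l -> S) (a : S) : nat := \sum_(i < l) (s i == a).
(** Counts are at most [l], so [inord] loses nothing, and storing them in ['I_l.+1] bounds the
    number of types by [l.+1 ^ #|S|]. The predicate [is_type] singles out the tuples that sum to
    [l]. *)
Definition type_of (s : 'I_l -> S) : {ffun S -> 'I_l.+1} := [ffun a => inord (count_of s a)].
Definition type_law (t : {ffun S -> 'I_l.+1}) (a : S) : R := (t a)%:R / l%:R.
Definition is_type (t : {ffun S -> 'I_l.+1}) : bool := (\sum_a t a == l)%N.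

Lemma type_ofE s a : type_of s a = count_of s a :> nat.
Proof.
rewrite ffunE inordK // ltnS /count_of -[leqRHS]card_ord -sum1_card.
by apply: leq_sum => i _; case: eqP.
Qed.

Lemma sum_count_of (V : nmodType) (s : 'I_l -> S) (F : S -> V) :
  \sum_i F (s i) = \sum_a F a *+ count_of s a.
Proof.
transitivity (\sum_i \sum_a F a *+ (s i == a)).
  apply: eq_bigr => i _; rewrite (bigD1 (s i)) //= eqxx mulr1n big1 ?addr0 // => a.
  by rewrite eq_sym => /negPf ->.
by rewrite exchange_big; apply: eq_bigr => a _; rewrite -sumrMnr.
Qed.

Lemma is_type_of s : is_type (type_of s).
Proof.
apply/eqP; under eq_bigr do rewrite type_ofE.
rewrite /count_of exchange_big -[RHS]card_ord -sum1_card; apply: eq_bigr => i _ /=.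
by rewrite (bigD1 (s i)) //= eqxx big1 ?addn0 // => a; rewrite eq_sym => /negPf ->.
Qed.

Lemma type_law_pdist t : is_type t -> q_pdist (type_law t).
Proof.
move=> /eqP ht; split=> [a|]; first by rewrite divr_ge0.
by rewrite -mulr_suml -natr_sum ht divff // pnatr_eq0 -lt0n.
Qed.

(* Among all laws q, the empirical law of s gives s the largest probability:
   with x_i = q(s_i) / type_law(s_i), sum x_i <= l while prod x_i <= exp (sum (x_i - 1)). *)
Lemma type_law_max (q : S -> R) (s : {ffun 'I_l -> S}) : q_pdist q ->
  prodw (fun=> q) s <= prodw (fun=> type_law (type_of s)) s.
Proof.
move=> [q0 q1]; set t := type_law _.
have l0 : 0 < l%:R :> R by rewrite ltr0n.
have t_gt0 i : 0 < t (s i).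
  rewrite /t /type_law divr_gt0 // ltr0n type_ofE /count_of (bigD1 i) //= eqxx //.
have t_ge0 a : 0 <= t a by rewrite /t /type_law divr_ge0.
pose x a := q a / t a.
have x0 a : 0 <= x a by rewrite divr_ge0.
have -> : prodw (fun=> q) s = (\prod_i x (s i)) * prodw (fun=> t) s.
  by rewrite -big_split; apply: eq_bigr => i _; rewrite /= divfK // gt_eqF.
rewrite -[leRHS]mul1r ler_wpM2r ?prodw_ge0 //.
apply: (@le_trans _ _ (\prod_(i < l) expR (x (s i) - 1))).
  apply: ler_prod => i _; rewrite x0 /=.
  by have := @expR_ge1Dx R (x (s i) - 1); rewrite addrC subrK.
rewrite -expR_sum -[leRHS]expR0 ler_expR sumrB subr_le0 sumr_const card_ord.
rewrite (sum_count_of s x) [leRHS](mean_const _ (conj q0 q1)).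
apply: ler_sum => a _; rewrite -[leLHS]mulr_natr /x /t /type_law type_ofE.
have [->|cn0] := eqVneq (count_of s a) 0%N; first by rewrite mulr0 mulr_ge0.
by rewrite invf_div mulrA divfK // pnatr_eq0.
Qed.

(** A measure of polynomial mass that dominates all i.i.d. laws on state words at once. *)
Definition type_cover (s : {ffun 'I_l -> S}) : R :=
  \sum_(t : {ffun S -> 'I_l.+1} | is_type t) prodw (fun=> type_law t) s.

Lemma type_cover_ge q s : q_pdist q -> prodw (fun=> q) s <= type_cover s.
Proof.
move=> hq; apply: le_trans (type_law_max s hq) _.
rewrite /type_cover (bigD1 (type_of s)) ?is_type_of //= lerDl sumr_ge0 // => t /andP[ht _].
by apply: prodw_ge0 => i y; case: (type_law_pdist ht).
Qed.

Lemma type_cover_ge0 s : 0 <= type_cover s.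
Proof.
by apply: sumr_ge0 => t ht; apply: prodw_ge0 => i y; case: (type_law_pdist ht).
Qed.

Lemma sum_type_cover : \sum_s type_cover s <= (l.+1 ^ #|S|)%:R.
Proof.
rewrite exchange_big /=.
apply: (@le_trans _ _ (\sum_(t : {ffun S -> 'I_l.+1}) 1)).
  rewrite big_mkcond; apply: ler_sum => t _; case: ifP => ht //.
  by rewrite prodw_sum1 // => i; case: (type_law_pdist ht).
by rewrite sumr_const card_ffun card_ord.
Qed.
End Types.

Lemma le_mean_exists {R : realType} (T : finType) (w g : T -> R) K :
  q_pdist w -> \sum_t w t * g t <= K -> exists t, g t <= K.
Proof.
move=> hw h; apply: contrapT => /forallNP hn.
have hlt t : K < g t by rewrite ltNge; apply/negP/hn.
have [w0 w1] := hw.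
have : \sum_t w t * g t - K <= 0 by rewrite subr_le0.
rewrite [X in _ - X](mean_const K hw) -sumrB.
under eq_bigr do rewrite -mulrBr.
move=> le0; have nn t : 0 <= w t * (g t - K) by rewrite mulr_ge0 // subr_ge0 ltW.
have /eqP : \sum_t w t * (g t - K) = 0 by apply/eqP; rewrite eq_le le0 sumr_ge0.
rewrite psumr_eq0 // => /allP hz.
have : \sum_t w t = 0.
  apply: big1 => t _; have := hz t (mem_index_enum t); rewrite mulf_eq0 subr_eq0.
  by rewrite (gt_eqF (hlt t)) orbF => /eqP.
by rewrite w1 => /eqP; rewrite oner_eq0.
Qed.

(** * Codes for state words and for mixtures *)

Section Codes.
Context {R : realType}.
Local Notation C := R[i].
Variables (X S : finType) (d : nat) (A : S -> X -> 'M[C]_d) (p : X -> R) (I k dl : R).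
Hypotheses (A_state : forall s x, q_is_state (A s x)) (p_pdist : q_pdist p).
Hypothesis (I_le : forall W, q_conv A W -> I <= q_holevo p W).
Hypotheses (k_gt0 : 0 < k) (k_lt1 : k < 1) (dl_gt0 : 0 < dl).

(** The three terms of [random_coding] with [c = expR (l dl)], one test per tuple of counts, and the
    [beta] of [exists_tests] with [I] in place of the Holevo information. *)
Definition code_bound (l M : nat) : R :=
  5 * expR (- (l%:R * chernoff_exp (smooth_log_bound d k) dl)) +
  (1 + expR (l%:R * dl))^-1 +
  expR (l%:R * dl) * M%:R * (l.+1 ^ #|S|)%:R *
  expR (- (l%:R * (ln 2 * I + ln (1 - k) - 2 * dl))).

(** The decoder is fixed before [s]: it contains the tests of all types, and the type of [s]
    provides the relevant one. *)
Lemma avc_random_code (l M : nat) : (0 < l)%N -> (0 < M)%N ->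
  exists D : {ffun 'I_M -> {ffun 'I_l -> X}} -> 'I_M -> 'M[C]_(q_tdim d l),
    (forall f, q_decoder_valid (D f)) /\
    forall s : 'I_l -> S,
      \sum_f prodw (fun=> prodw (fun=> p)) f *
        q_code_err (fun i => A (s i)) (fun m => f m) (D f) <= code_bound l M.
Proof.
move=> l0 M0; have lR : 0 < l%:R :> R by rewrite ltr0n.
pose T := {ffun S -> 'I_l.+1}.
set beta := expR (- (l%:R * (ln 2 * I + ln (1 - k) - 2 * dl))).
set e := 5 * expR (- (l%:R * chernoff_exp (smooth_log_bound d k) dl)).
pose W (t : T) x := \sum_a (type_law t a : R)%:C%C *: A a x.
have hE (t : T) : exists E : {ffun 'I_l -> X} -> 'M[C]_(q_tdim d l),
  [/\ forall x, q_psd (E x), forall x, q_psd (1%:M - E x),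
      q_psd (beta%:C%C *: 1%:M - \sum_x (prodw (fun=> p) x)%:C%C *: E x) &
      is_type t -> forall rho : 'I_l -> X -> 'M[C]_d,
        (forall i x, q_is_state (rho i x)) ->
        (forall x, \sum_i rho i x = (l%:R : R)%:C%C *: W t x) ->
        \sum_x prodw (fun=> p) x * ev (q_tens (fun i => rho i (x i))) (1%:M - E x) <= e].
  have b0 : 0 <= beta by exact: expR_ge0.
  case ht : (is_type t); last first.
    (* A tuple of counts that is not a type gets the zero test, which never raises a false alarm. *)
    exists (fun=> 0); split=> // [x|x|]; first exact: psd0.
      by rewrite subr0; exact: psd1.
    rewrite big1 ?subr0 => [|x _]; last by rewrite scaler0.
    by apply: psdZ => //; exact: psd1.
  have hq := type_law_pdist (R := R) l0 ht.
  have hW x : q_is_state (W t x) by apply: mix_state.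
  have hC : q_conv A (W t) by exists (type_law t).
  have [E [h1 h2 h3 h4]] := exists_tests l p_pdist hW k_gt0 k_lt1 dl_gt0.
  exists E; split; [exact: h1|exact: h2| |move=> _; exact: h4].
  set B := _%:C%C *: 1%:M in h3; set B' := _%:C%C *: 1%:M.
  have hB : q_psd (B' - B).
    rewrite /B /B' -scalerBl -rmorphB; apply: psdZ; last exact: psd1.
    rewrite subr_ge0 ler_expR lerN2 ler_wpM2l // !lerD2r ler_wpM2l //.
      exact/ltW/ln2_gt0.
    exact: I_le.
  by have := psdD hB h3; rewrite addrA subrK.
have [E hE'] := choice hE.
exists (book_decoder E (expR (l%:R * dl))); split.
  move=> f; apply: book_decoder_valid; last exact: expR_gt0.
  by move=> t y; case: (hE' t).
move=> s; rewrite /code_bound.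
have wp : q_pdist (prodw (fun=> p) : {ffun 'I_l -> X} -> R).
  case: p_pdist => p0 p1; split=> [x|]; first exact: prodw_ge0.
  by rewrite prodw_sum1.
have Em : \sum_x prodw (fun=> p) x *
    ev (q_tens (fun i => A (s i) (x i))) (1%:M - E (type_of s) x) <= e.
  case: (hE' (type_of s)) => _ _ _ h; apply: (h (is_type_of s) (fun i => A (s i))) => // x.
  rewrite (sum_count_of s (fun a => A a x)) /W scaler_sumr; apply: eq_bigr => a _.
  rewrite scalerA -rmorphM /type_law type_ofE mulrC divfK ?(gt_eqF lR) //.
  by rewrite rmorph_nat scaler_nat.
have := random_coding (rho := fun x : {ffun 'I_l -> X} => q_tens (fun i => A (s i) (x i)))
  wp (fun x => tens_state (fun i => A_state (s i) (x i)))
  (fun t => let: And4 h _ _ _ := hE' t in h) (fun t => let: And4 _ h _ _ := hE' t in h)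
  (fun t => let: And4 _ _ h _ := hE' t in h) Em (expR_ge0 _) (expR_gt0 (l%:R * dl)) M0.
by rewrite card_ffun card_ord.
Qed.

Lemma mix_code_err (l M : nat) (q : S -> R) (u : 'I_M -> 'I_l -> X) D :
  q_code_err (fun _ x => \sum_s (q s)%:C%C *: A s x) u D =
  \sum_(s : {ffun 'I_l -> S}) prodw (fun=> q) s * q_code_err (fun i => A (s i)) u D.
Proof.
rewrite /q_code_err; under [RHS]eq_bigr do rewrite mulrCA mulr_sumr.
rewrite -mulr_sumr exchange_big /=; congr (_ * _); apply: eq_bigr => m _.
rewrite -/(ev _ _) (tens_mix (fun=> q) (fun i s => A s (u m i))) ev_suml.
by apply: eq_bigr => s _; rewrite evZl.
Qed.

Lemma decoder_compl_psd n M (D : 'I_M -> 'M[C]_n) m :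
  q_decoder_valid D -> q_psd (1%:M - D m).
Proof.
case=> D0 D1; have -> : 1%:M - D m = (1%:M - \sum_m D m) + \sum_(m' | m' != m) D m'.
  by rewrite [\sum_m D m](bigD1 m) //= opprD addrA subrK.
by apply: (psdD D1); apply: psd_sum => m' _; exact: D0.
Qed.

Lemma code_err_ge0 (l M : nat) (W : 'I_l -> X -> 'M[C]_d) (u : 'I_M -> 'I_l -> X) D :
  (forall i x, q_is_state (W i x)) -> q_decoder_valid D -> 0 <= q_code_err W u D.
Proof.
move=> hW hD; rewrite /q_code_err mulr_ge0 // sumr_ge0 // => m _.
by apply: (ev_ge0 _ (decoder_compl_psd m hD)); apply: tens_psd => i; case: (hW i (u m i)).
Qed.

(** Averaging the errors over state words with [type_cover] instead of a single i.i.d. law yields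
    one codebook that is good for the cover, hence for every mixture by domination. The mass of the
    cover is the extra factor. *)
Lemma compound_code (l M : nat) : (0 < l)%N -> (0 < M)%N ->
  exists (u : 'I_M -> 'I_l -> X) (D : 'I_M -> 'M[C]_(q_tdim d l)),
    q_decoder_valid D /\
    forall W, q_conv A W ->
      q_code_err (fun=> W) u D <= (l.+1 ^ #|S|)%:R * code_bound l M.
Proof.
move=> l0 M0; have [D [hD hs]] := avc_random_code l0 M0.
have [p0 p1] := p_pdist.
set w := prodw _ in hs.
have wp : q_pdist w.
  split=> [f|]; first by apply: prodw_ge0 => _ x; apply: prodw_ge0.
  by apply: prodw_sum1 => _; apply: prodw_sum1.
pose err f (s : {ffun 'I_l -> S}) :=
  q_code_err (fun i => A (s i)) (fun m => (f : {ffun 'I_M -> {ffun 'I_l -> X}}) m) (D f).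
have err0 f s : 0 <= err f s by apply: code_err_ge0.
have cb0 : 0 <= code_bound l M.
  rewrite /code_bound !addr_ge0 ?mulr_ge0 ?expR_ge0 // invr_ge0 addr_ge0 // expR_ge0.
have [f hf] : exists f, \sum_s type_cover s * err f s <= (l.+1 ^ #|S|)%:R * code_bound l M.
  apply: (le_mean_exists wp); under eq_bigr do rewrite mulr_sumr.
  rewrite exchange_big /=; apply: le_trans (ler_wpM2r cb0 (sum_type_cover S l0)).
  rewrite mulr_suml; apply: ler_sum => s _; under eq_bigr do rewrite mulrCA.
  rewrite -mulr_sumr ler_wpM2l ?type_cover_ge0 //; exact: hs.
exists (fun m => f m), (D f); split=> // W [q [hq ->]].
rewrite mix_code_err; apply: le_trans hf; apply: ler_sum => s _.
by rewrite ler_wpM2r ?type_cover_ge //; apply: err0.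
Qed.
End Codes.

(** * Asymptotics *)

Local Open Scope classical_set_scope.
Local Open Scope ring_scope.

(** The Taylor term of order [n.+1] of the exponential at [l.+1 * c] leaves a bound [K / l.+1]; the
    factor [expR c] in [K] pays for the shift from [l] to [l.+1]. *)
Lemma poly_exp_cvg0 {R : realType} (n : nat) (c : R) : 0 < c ->
  (fun l : nat => (l.+1)%:R ^+ n * expR (- (l%:R * c))) @ \oo --> (0 : R).
Proof.
move=> c0; pose K := expR c * (n.+1)`!%:R / c ^+ n.+1.
have hK : (fun l => K * harmonic l) @ \oo --> (0 : R).
  by rewrite -(mulr0 K); apply: cvgMr; exact: cvg_harmonic.
apply: (squeeze_cvgr _ _ hK); last exact: (@cvg_cst _ (0 : R)).
near=> l; apply/andP; split; first by rewrite mulr_ge0 ?exprn_ge0 ?expR_ge0.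
have l1 : 0 < l.+1%:R :> R by rewrite ltr0n.
have fp : 0 < (n.+1)`!%:R :> R by rewrite ltr0n fact_gt0.
have h : (l.+1%:R * c) ^+ n.+1 / (n.+1)`!%:R <= expR (l.+1%:R * c).
  apply: le_trans (expR_ge1Dxn n _); last by rewrite mulr_ge0 // ltW.
  by rewrite lerDr.
rewrite /harmonic /= /K.
have -> : - (l%:R * c) = c - l.+1%:R * c by rewrite -natr1; ring.
rewrite expRB mulrA ler_pdivrMr ?expR_gt0 //.
have -> : expR c * (n.+1)`!%:R / c ^+ n.+1 / l.+1%:R * expR (l.+1%:R * c) =
   expR c * ((n.+1)`!%:R / (c ^+ n.+1 * l.+1%:R) * expR (l.+1%:R * c)).
  by field; rewrite ?gt_eqF // ?exprn_gt0.
rewrite mulrC ler_wpM2l ?expR_ge0 //.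
apply: le_trans (ler_wpM2l _ h); last by rewrite divr_ge0 // ?mulr_ge0 // ?exprn_ge0 // ltW.
rewrite le_eqVlt; apply/orP; left; apply/eqP.
have cn : c ^+ n.+1 != 0 by rewrite expf_neq0 // gt_eqF.
rewrite exprMn (exprS l.+1%:R n); move: (c ^+ n.+1) cn => C cn; field.
by rewrite cn !gt_eqF.
Unshelve. all: by end_near.
Qed.

Lemma limn_einf_ge {R : realType} (r : R) (v : nat -> R) :
  (forall l, (0 < l)%N -> r <= v l) -> (r%:E <= limn_einf (fun l => (v l)%:E))%E.
Proof.
move=> h; rewrite limn_einf_lim; apply: lime_ge; first exact: is_cvg_einfs.
near=> n; apply: le_ereal_inf_tmp => _ [k /= nk <-]; rewrite lee_fin; apply: h.
apply: leq_trans nk; near: n; exact: nbhs_infty_gt.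
Unshelve. all: by end_near.
Qed.

Lemma limn_einf_lt {R : realType} (r e : R) (v : nat -> R) : 0 < e ->
  (r%:E <= limn_einf (fun l => (v l)%:E))%E -> \forall l \near \oo, r - e < v l.
Proof.
move=> e0; rewrite limn_einf_lim (cvg_lim _ (@cvg_einfs_sup _ _)) // => h.
have : ((r - e)%:E < ereal_sup (range (einfs (fun l => (v l)%:E))))%E.
  by apply: lt_le_trans h; rewrite lte_fin ltrBlDr ltrDl.
move=> /ereal_sup_gt[_ [n _ <-]] hn; exists n => // l /= nl.
rewrite -lte_fin; apply: lt_le_trans hn _; apply: ereal_inf_lbound.
by exists l.
Qed.

(** Nonemptiness keeps the supremum from being minus infinity, so it is squeezed between 0 and
    [g]. *)
Lemma ereal_sup_cvg0 {R : realType} (T : nat -> Type) (D : forall l, set (T l))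
    (f : forall l, T l -> \bar R) (g : nat -> R) :
  (forall l, D l !=set0) -> (forall l t, D l t -> (0 <= f l t)%E) ->
  (forall l t, (0 < l)%N -> D l t -> (f l t <= (g l)%:E)%E) -> g @ \oo --> (0 : R) ->
  (fun l => ereal_sup [set f l t | t in D l]) @ \oo --> 0%E.
Proof.
move=> D0 f0 fg hg.
apply: (@squeeze_cvge _ _ _ _ (fun=> 0%E) _ (EFin \o g)); last 2 first.
- exact: cvg_cst.
- by apply: cvg_EFin => //; exact: nearW.
near=> l; apply/andP; split.
  have [t0 Dt0] := D0 l.
  by apply: (@le_trans _ _ (f l t0)); [exact: f0|apply: ereal_sup_ubound; exists t0].
apply: ge_ereal_sup => _ [t Dt <-]; rewrite fg //.
near: l; exact: nbhs_infty_gt.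
Unshelve. all: by end_near.
Qed.

(** * Finitely supported probabilities on [nat] *)

Section FiniteProbability.
Context {R : realType}.
Variables (N : nat) (w : nat -> R) (w_ge0 : forall k, 0 <= w k).
Hypothesis w_sum1 : \sum_(k < N) w k = 1.

(** A mixture of Dirac masses; the sigma-algebra of [nat] is discrete, so error functions are
    measurable for free. *)
Definition nat_prob : set nat -> \bar R :=
  msum (fun k => mscale (NngNum (w_ge0 k)) (\d_k : {measure set nat -> \bar R})) N.

HB.instance Definition _ := Measure.on nat_prob.

Lemma nat_prob_setT : nat_prob setT = 1%E.
Proof.
rewrite -w_sum1 -sumEFin; apply: eq_bigr => k _.
by rewrite /mscale /= /mscale /= /dirac indicE in_setT mule1.
Qed.

HB.instance Definition _ := @Measure_isProbability.Build _ _ R nat_prob nat_prob_setT.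

Lemma integral_nat_prob (f : nat -> R) : (forall k, 0 <= f k) ->
  (\int[nat_prob]_k (f k)%:E)%E = (\sum_(k < N) w k * f k)%:E.
Proof.
move=> f0; rewrite ge0_integral_measure_sum //= => [|k _]; last by rewrite lee_fin.
rewrite -sumEFin; apply: eq_bigr => k _.
rewrite ge0_integral_mscale //= => [|j _]; last by rewrite lee_fin.
by rewrite integral_dirac //= diracT mul1e.
Qed.

Lemma exists_nat_prob : exists P : probability nat R,
  forall f : nat -> R, (forall k, 0 <= f k) ->
    (\int[P]_k (f k)%:E)%E = (\sum_(k < N) w k * f k)%:E.
Proof. by exists nat_prob; exact: integral_nat_prob. Qed.
End FiniteProbability.

(** * Achievability *)

Lemma rate_parameters {R : realType} (S : finType) (d : nat) (I r : R) :
  (0 < d)%N -> 0 <= r -> r < I ->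
  exists k dl c1 (M : nat -> nat),
  [/\ 0 < k /\ k < 1, 0 < dl, 0 < c1,
      forall l, (0 < M l)%N /\ ((0 < l)%N -> r <= q_log2 (M l)%:R / l%:R) &
      forall l, (l.+1 ^ #|S|)%:R * code_bound S d I k dl l (M l) <=
        8 * (l.+1%:R ^+ (2 * #|S|) * expR (- (l%:R * c1)))].
Proof.
move=> d0 r0 rI.
have L0 := @ln2_gt0 R.
(* A tenth of the rate slack in nats: the false-alarm exponent spends four of the ten parts, one on
   [c], one on [ln (1 - k)] and two on typicality, so six remain. *)
pose dl := (I - r) * ln 2 / 10.
have dl0 : 0 < dl by rewrite divr_gt0 // mulr_gt0 // subr_gt0.
(* Chosen so that [ln (1 - k) = - dl]. *)
pose k := 1 - expR (- dl).
have k0 : 0 < k by rewrite subr_gt0 expR_lt1 oppr_lt0.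
have k1 : k < 1 by rewrite ltrBlDr ltrDl expR_gt0.
have lnk : ln (1 - k) = - dl by rewrite /k subKr expRK.
have B0 : 0 <= smooth_log_bound d k.
  rewrite oppr_ge0 ln_le0 // ler_pdivrMr ?ltr0n // mul1r (le_trans (ltW k1)) // ler1n //.
pose c0 := chernoff_exp (smooth_log_bound d k) dl.
have c00 : 0 < c0 by exact: chernoff_exp_gt0.
pose c1 := Num.min c0 dl.
have c1c0 : c1 <= c0 by rewrite ge_min lexx.
have c1dl : c1 <= dl by rewrite ge_min lexx orbT.
pose E l := expR (l%:R * (r * ln 2)).
(* The successor of the truncation is at least [E l], and at most [2 E l] because [E l >= 1]. In the
   final constant, [8 = 5 + 1 + 2]. *)
pose M l := (Num.truncn (E l)).+1.
have E1 l : 1 <= E l by rewrite -expR0 ler_expR mulr_ge0 // mulr_ge0 // ltW.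
have E0 l : 0 <= E l by exact: expR_ge0.
have ME l : E l <= (M l)%:R by have /andP[_ /ltW] := truncn_itv (E0 l).
have ME2 l : (M l)%:R <= 2 * E l.
  rewrite /M -natr1; have /andP[h _] := truncn_itv (E0 l); have := E1 l; lra.
exists k, dl, c1, M; split=> //.
- by rewrite lt_min c00.
- move=> l; split=> // l0; rewrite /q_log2 ler_pdivlMr ?ltr0n // ler_pdivlMr //.
  rewrite -[leLHS]expRK ler_ln ?posrE ?expR_gt0 ?ltr0n //.
  by rewrite mulrAC mulrC; apply: ME.
move=> l; set Q := expR (- (l%:R * c1)).
have Q0 : 0 < Q by exact: expR_gt0.
set P := (l.+1 ^ #|S|)%:R : R.
have P1 : 1 <= P by rewrite ler1n expn_gt0.
have l0 : 0 <= l%:R :> R by [].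
have h1 : expR (- (l%:R * c0)) <= Q by rewrite ler_expR lerN2 ler_wpM2l.
have h2 : (1 + expR (l%:R * dl))^-1 <= Q.
  apply: (@le_trans _ _ (expR (- (l%:R * dl)))); last by rewrite ler_expR lerN2 ler_wpM2l.
  have a0 : 0 < expR (l%:R * dl) by exact: expR_gt0.
  by rewrite expRN lef_pV2 ?posrE ?lerDr ?addr_gt0.
have h3 : expR (l%:R * dl) * E l * expR (- (l%:R * (ln 2 * I + ln (1 - k) - 2 * dl))) <= Q.
  rewrite /E -!expRD ler_expR lnk.
  have e : ln 2 * I = ln 2 * r + 10 * dl by rewrite /dl; field.
  rewrite e (_ : _ + _ = - (6 * (l%:R * dl))); last by ring.
  have := ler_wpM2l l0 c1dl; have := mulr_ge0 l0 (ltW dl0); lra.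
have h4 : code_bound S d I k dl l (M l) <= 8 * (P * Q).
  rewrite /code_bound -/c0 -/P.
  set e1 := expR _ in h1 *; set e2 := _^-1 in h2 *.
  set a := expR (l%:R * dl) in h3 *; set b := expR _ in h3 *.
  have a0 : 0 <= a by exact: expR_ge0.
  have b0 : 0 <= b by exact: expR_ge0.
  have h5 : a * (M l)%:R * P * b <= 2 * (P * Q).
    apply: (@le_trans _ _ (a * (2 * E l) * P * b)).
      by rewrite !ler_wpM2r // ?ler_wpM2l // (le_trans _ P1).
    have -> : a * (2 * E l) * P * b = 2 * (P * (a * E l * b)) by ring.
    by rewrite ler_wpM2l // ler_wpM2l // (le_trans _ P1).
  have h6 : Q <= P * Q by rewrite ler_peMl // ltW.
  lra.
apply: le_trans (ler_wpM2l (le_trans ler01 P1) h4) _.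
rewrite mulnC exprM expr2 /P natrX !mulrA le_eqVlt; apply/orP; left; apply/eqP; ring.
Qed.

Section Achievability.
Context {R : realType}.
Local Notation C := R[i].
Variables (X S : finType) (d : nat) (A : S -> X -> 'M[C]_d) (p : X -> R) (I r : R).
Hypotheses (X_gt0 : (0 < #|X|)%N) (S_gt0 : (0 < #|S|)%N).
Hypotheses (A_state : forall s x, q_is_state (A s x)) (p_pdist : q_pdist p).
Hypothesis (I_le : forall W, q_conv A W -> I <= q_holevo p W).

Lemma conv_state W : q_conv A W -> forall x, q_is_state (W x).
Proof. by case=> q [hq ->] x; apply: mix_state. Qed.

Lemma conv_nonempty : q_conv A !=set0.
Proof.
have /card_gt0P[s0 _] := S_gt0.
exists (fun x => \sum_s ((s == s0)%:R : R)%:C%C *: A s x), (fun s => (s == s0)%:R).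
split=> //; split=> [s|]; first by rewrite ler0n.
by rewrite (bigD1 s0) //= eqxx big1 ?addr0 // => s /negPf ->.
Qed.

Lemma dim_gt0 : (0 < d)%N.
Proof.
have /card_gt0P[s0 _] := S_gt0; have /card_gt0P[x0 _] := X_gt0.
by have [V [q [_ hq _]]] := state_spectral (A_state s0 x0); apply: pdist_ord_gt0 hq.
Qed.

Lemma trivial_decoder n : q_decoder_valid (fun _ : 'I_1 => 1%:M : 'M[C]_n).
Proof.
split=> [_|]; first exact: psd1.
by rewrite big_ord1 subrr; exact: psd0.
Qed.

Lemma trivial_err l (W : 'I_l -> X -> 'M[C]_d) (u : 'I_1 -> 'I_l -> X) :
  q_code_err W u (fun=> 1%:M) = 0.
Proof. by rewrite /q_code_err big1 ?mulr0 // => m _; rewrite subrr mulmx0 mxtrace0. Qed.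

Lemma zero_decoder n M : q_decoder_valid (fun _ : 'I_M => 0 : 'M[C]_n).
Proof.
split=> [_|]; first exact: psd0.
by rewrite big1 // subr0; exact: psd1.
Qed.

(** A single message that is always decoded has error 0 and rate 0. This also shows that the
    capacity is nonnegative. *)
Lemma trivial_achievable r' : r' <= 0 -> q_det_achievable (q_conv A) r'.
Proof.
move=> r0; have /card_gt0P[x0 _] := X_gt0.
exists (fun=> 1%N), (fun _ _ _ => x0), (fun _ _ => 1%:M); split=> //; split.
  by move=> l; exact: trivial_decoder.
split.
  by apply: limn_einf_ge => l _; rewrite /q_log2 ln1 !mul0r.
apply: (@ereal_sup_cvg0 _ _ (fun=> q_conv A) (fun l W => (q_code_err _ _ _)%:E)
  (fun=> 0) (fun=> conv_nonempty)).
- by move=> l t _; rewrite trivial_err.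
- by move=> l t _ _; rewrite trivial_err.
- exact: cvg_cst.
Qed.

Hypothesis r_lt : r < I.

Lemma compound_achievable : q_det_achievable (q_conv A) r.
Proof.
have /card_gt0P[x0 _] := X_gt0.
have [r0|r0] := leP 0 r; last exact: trivial_achievable (ltW r0).
have [k [dl [c1 [M [[k0 k1] dl0 c10 hM hb]]]]] := rate_parameters S dim_gt0 r0 r_lt.
have M0 l : (0 < M l)%N by case: (hM l).
have hcode l : exists uD : ('I_(M l) -> 'I_l -> X) * ('I_(M l) -> 'M[C]_(q_tdim d l)),
    q_decoder_valid uD.2 /\ ((0 < l)%N -> forall W, q_conv A W ->
      q_code_err (fun=> W) uD.1 uD.2 <= (l.+1 ^ #|S|)%:R * code_bound S d I k dl l (M l)).
  case: (posnP l) => [l0|l0].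
    by exists (fun _ _ => x0, fun=> 0); split=> //=; exact: zero_decoder.
  have [u [D [h1 h2]]] := compound_code A_state p_pdist I_le k0 k1 dl0 l0 (M0 l).
  by exists (u, D).
(* The type of the code depends on [l], so the choice is made for each [l] separately. *)
pose uD l := projT1 (cid (hcode l)).
have huD l := projT2 (cid (hcode l)).
exists M, (fun l => (uD l).1), (fun l => (uD l).2); split=> //; split.
  by move=> l; case: (huD l).
split; first by apply: limn_einf_ge => l; case: (hM l).
apply: (@ereal_sup_cvg0 _ _ (fun=> q_conv A) (fun l W => (q_code_err _ _ _)%:E)
  (fun l => 8 * (l.+1%:R ^+ (2 * #|S|) * expR (- (l%:R * c1)))) (fun=> conv_nonempty)).
- move=> l W hW; apply: code_err_ge0; last by case: (huD l).
  by move=> _ x; apply: conv_state.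
- move=> l W l0 hW; apply: le_trans (hb l); case: (huD l) => _ h; exact: h.
- by rewrite -(mulr0 8); apply: cvgMr; apply: poly_exp_cvg0.
Qed.

(** Moves a finite law to [nat] by enumeration; indices past the end give the code of [f0], which is
    valid and carries no mass. *)
Lemma finite_random_code (l M : nat) (F : finType) (f0 : F) (w : F -> R)
    (u : F -> 'I_M -> 'I_l -> X) (D : F -> 'I_M -> 'M[C]_(q_tdim d l)) (K : R) :
  q_pdist w -> (forall f, q_decoder_valid (D f)) ->
  (forall s : 'I_l -> S, \sum_f w f * q_code_err (fun i => A (s i)) (u f) (D f) <= K) ->
  exists (P : probability nat R) (u' : nat -> 'I_M -> 'I_l -> X)
      (D' : nat -> 'I_M -> 'M[C]_(q_tdim d l)),
    (forall k, q_decoder_valid (D' k)) /\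
    forall s : 'I_l -> S,
      (\int[P]_k (q_code_err (fun i => A (s i)) (u' k) (D' k))%:E <= K%:E)%E.
Proof.
move=> [w0 w1] hD hK.
pose b (k : nat) : F := nth f0 (enum F) k.
have sum_b (h : F -> R) : \sum_(k < #|F|) h (b k) = \sum_f h f.
  by rewrite cardE -[RHS]big_enum /= (big_nth f0) big_mkord.
have wb1 : \sum_(k < #|F|) w (b k) = 1 by rewrite sum_b.
have [P hP] := exists_nat_prob (fun k => w0 (b k)) wb1.
exists P, (fun k => u (b k)), (fun k => D (b k)); split=> [k|s]; first exact: hD.
rewrite hP => [|k]; last by apply: code_err_ge0.
by rewrite lee_fin (sum_b (fun f => w f * q_code_err (fun i => A (s i)) (u f) (D f))).
Qed.

Lemma random_achievable : q_rand_achievable A r.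
Proof.
have /card_gt0P[x0 _] := X_gt0; have /card_gt0P[s0 _] := S_gt0.
pose f0 l : {ffun 'I_l -> X} := [ffun=> x0].
have [M [g [M0 Mr g0 hcode]]] : exists (M : nat -> nat) (g : nat -> R),
    [/\ forall l, (0 < M l)%N, forall l, (0 < l)%N -> r <= q_log2 (M l)%:R / l%:R,
        g @ \oo --> (0 : R) &
        forall l, exists (D : {ffun 'I_(M l) -> {ffun 'I_l -> X}} -> 'I_(M l) -> 'M[C]_(q_tdim d l)),
         (forall f, q_decoder_valid (D f)) /\
         ((0 < l)%N -> forall s : 'I_l -> S, \sum_f prodw (fun=> prodw (fun=> p)) f *
           q_code_err (fun i => A (s i)) (fun m => f m) (D f) <= g l)].
  have [r0|r0] := leP 0 r; last first.
    exists (fun=> 1%N), (fun=> 0); split=> //.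
    - by move=> l _; rewrite /q_log2 ln1 !mul0r ltW.
    - exact: cvg_cst.
    - move=> l; exists (fun _ _ => 1%:M); split=> [_|_ s]; first exact: trivial_decoder.
      by rewrite big1 // => f _; rewrite trivial_err mulr0.
  have [k [dl [c1 [M [[k0 k1] dl0 c10 hM hb]]]]] := rate_parameters S dim_gt0 r0 r_lt.
  have M0 l : (0 < M l)%N by case: (hM l).
  exists M, (fun l => 8 * (l.+1%:R ^+ (2 * #|S|) * expR (- (l%:R * c1)))); split=> //.
  - by move=> l; case: (hM l).
  - by rewrite -(mulr0 8); apply: cvgMr; apply: poly_exp_cvg0.
  move=> l; case: (posnP l) => [l0|l0].
    by exists (fun _ => fun=> 0); split=> // _; exact: zero_decoder.
  have [D [h1 h2]] := avc_random_code A_state p_pdist I_le k0 k1 dl0 l0 (M0 l).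
  exists D; split=> // _ s; apply: le_trans (h2 s) _; apply: le_trans (hb l).
  rewrite ler_peMl ?ler1n ?expn_gt0 //.
  by rewrite /code_bound !addr_ge0 ?mulr_ge0 ?expR_ge0 // invr_ge0 addr_ge0 // expR_ge0.
have hrand l : exists Q : probability nat R * ((nat -> 'I_(M l) -> 'I_l -> X) *
      (nat -> 'I_(M l) -> 'M[C]_(q_tdim d l))),
    (forall k, q_decoder_valid (Q.2.2 k)) /\
    ((0 < l)%N -> forall s : 'I_l -> S,
      (\int[Q.1]_k (q_code_err (fun i => A (s i)) (Q.2.1 k) (Q.2.2 k))%:E <= (g l)%:E)%E).
  have [D [hD hs]] := hcode l.
  have wp : q_pdist (prodw (fun=> prodw (fun=> p)) : {ffun 'I_(M l) -> {ffun 'I_l -> X}} -> R).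
    case: p_pdist => p0 p1; split=> [f|]; first by apply: prodw_ge0 => _ x; apply: prodw_ge0.
    by apply: prodw_sum1 => _; apply: prodw_sum1.
  (* At block length 0 nothing is claimed about [g], but a bound is still needed; the sum of all
     errors is one. *)
  pose K := if (0 < l)%N then g l else
     \sum_(s : {ffun 'I_l -> S}) \sum_f prodw (fun=> prodw (fun=> p)) f *
           q_code_err (fun i => A (s i)) (fun m => (f : {ffun 'I_(M l) -> {ffun 'I_l -> X}}) m) (D f).
  have hK (s : 'I_l -> S) : \sum_f prodw (fun=> prodw (fun=> p)) f *
           q_code_err (fun i => A (s i)) (fun m => (f : {ffun 'I_(M l) -> {ffun 'I_l -> X}}) m) (D f) <= K.
    rewrite /K; case: ifP => l0; first exact: hs.
    have -> : s = finfun s :> ('I_l -> S) by apply/funext => i; rewrite ffunE.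
    rewrite [leRHS](bigD1 (finfun s)) //= lerDl sumr_ge0 // => t _.
    apply: sumr_ge0 => f _; rewrite mulr_ge0 //; first by case: wp.
    exact: code_err_ge0.
  have [P [u' [D' [h1 h2]]]] := finite_random_code [ffun=> f0 l] wp hD hK.
  exists (P, (u', D')); split=> //= l0 s; apply: le_trans (h2 s) _.
  by rewrite /K l0.
pose Q l := projT1 (cid (hrand l)).
have hQ l := projT2 (cid (hrand l)).
exists M; split=> //; split; first exact: limn_einf_ge.
exists (fun=> _), (fun=> nat), (fun l => (Q l).1), (fun l => (Q l).2.1), (fun l => (Q l).2.2).
split; first by move=> l k; case: (hQ l).
split; first by [].
apply: (@ereal_sup_cvg0 R (fun l => 'I_l -> S) (fun=> setT) (fun l s =>
  (\int[(Q l).1]_k (q_code_err (fun i => A (s i)) ((Q l).2.1 k) ((Q l).2.2 k))%:E)%E) g).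
- by move=> l; exists (fun=> s0).
- move=> l s _; apply: integral_ge0 => k _; rewrite lee_fin.
  by apply: code_err_ge0 => //; case: (hQ l).
- by move=> l s l0 _; case: (hQ l) => _; apply.
- exact: g0.
Qed.
End Achievability.

(** * Converse *)

Lemma dg_state {R : realType} n (V : 'M[R[i]]_n) (s : 'I_n -> R) :
  V \is unitarymx -> q_pdist s -> q_is_state (dg V s).
Proof.
move=> Vu [s0 s1]; split; first exact: psd_dg.
rewrite /dg mxtrace_mulC mulmxA (unitarymxP Vu) mul1mx mxtrace_diag.
by under eq_bigr do rewrite mxE; rewrite -rmorph_sum /= s1.
Qed.

Section Overlap.
Context {R : realType}.
Local Notation C := R[i].
Variables (n : nat) (U V : 'M[C]_n).
Hypotheses (Uu : U \is unitarymx) (Vu : V \is unitarymx).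

Lemma sum_overlapr a : \sum_b overlap U V a b = 1.
Proof.
have UVu : U *m V^t* \is unitarymx.
  by apply: mul_unitarymx; [exact: Uu|rewrite trmxC_unitary].
rewrite /overlap; move: (U *m V^t*) UVu => Z /unitarymxP/matrixP/(_ a a).
rewrite [RHS]mxE eqxx mxE => h.
apply: (@complexI R); rewrite rmorph_sum rmorph1 -[RHS]h; apply: eq_bigr => b _.
by rewrite !mxE nsqE.
Qed.

Lemma outp_overlap r b : outp V (dg U r) b = \sum_a r a * overlap U V a b.
Proof.
rewrite /outp /dg.
have -> : V *m (U^t* *m diag_mx (\row_j (r j)%:C%C) *m U) *m V^t* =
    (U *m V^t*)^t* *m diag_mx (\row_j (r j)%:C%C) *m (U *m V^t*).
  by rewrite dagM trmxCK !mulmxA.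
rewrite /overlap; move: (U *m V^t*) => Z.
rewrite mxE Re_sum; apply: eq_bigr => a _; rewrite mul_mx_diag !mxE.
rewrite mulrAC mulrC [X in _ * X]mulrC nsqE ReZ //.
Qed.
End Overlap.

Section Converse.
Context {R : realType}.
Local Notation C := R[i].
Variables (X : finType) (d : nat) (W : X -> 'M[C]_d).
Variables (Vx : X -> 'M[C]_d) (rx : X -> 'I_d -> R) (V : 'M[C]_d) (s : 'I_d -> R).
Hypotheses (Vxu : forall x, Vx x \is unitarymx) (rx_pdist : forall x, q_pdist (rx x)).
Hypotheses (Wx : forall x, W x = dg (Vx x) (rx x)).
Hypotheses (Vu : V \is unitarymx) (s_pdist : q_pdist s) (s_gt0 : forall b, 0 < s b).

(** The first Nussbaum-Szkola law of [W x] against [dg V s]. The overlap is common to both laws and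
    cancels in the ratio, so [ns_llr] contains eigenvalues only, and [ns_mean] is the relative
    entropy in nats. Pairs with [rx x z.1 = 0] carry no weight. *)
Definition ns_law x (z : 'I_d * 'I_d) : R := rx x z.1 * overlap (Vx x) V z.1 z.2.
Definition ns_llr x (z : 'I_d * 'I_d) : R := ln (rx x z.1) - ln (s z.2).
Definition ns_mean x : R := \sum_z ns_law x z * ns_llr x z.
Definition ns_bound : R := \sum_x \sum_z `|ns_llr x z|.

Lemma ns_law_pdist x : q_pdist (ns_law x).
Proof.
have [r0 r1] := rx_pdist x; split=> [z|]; first by rewrite mulr_ge0 // nsq_ge0.
rewrite -(pair_bigA _ (fun a b => rx x a * overlap (Vx x) V a b)) /= -r1.
by apply: eq_bigr => a _; rewrite -mulr_sumr (sum_overlapr (Vxu x) Vu) mulr1.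
Qed.

Lemma ns_llr_le x z : `|ns_llr x z| <= ns_bound.
Proof.
rewrite /ns_bound (bigD1 x) //= (bigD1 z) //= -addrA lerDl addr_ge0 //.
  exact: sumr_ge0.
by apply: sumr_ge0 => y _; apply: sumr_ge0.
Qed.

Lemma ns_bound_ge0 : 0 <= ns_bound.
Proof. by apply: sumr_ge0 => x _; apply: sumr_ge0. Qed.

Lemma ns_mean_le x : `|ns_mean x| <= ns_bound.
Proof.
have [w0 w1] := ns_law_pdist x.
apply: le_trans (ler_norm_sum _ _ _) _.
rewrite [leRHS](mean_const _ (ns_law_pdist x)); apply: ler_sum => z _.
by rewrite normrM ger0_norm // ler_wpM2l // ns_llr_le.
Qed.

(** Summing out [b] leaves the entropy of [W x], and summing out [a] leaves its outcome law in the
    basis [V]; the result no longer mentions the eigenbasis of [W x]. *)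
Lemma ns_meanE x :
  ns_mean x = - (ln 2 * q_entropy (W x)) - \sum_b outp V (W x) b * ln (s b).
Proof.
rewrite {1}Wx (entropy_nat _ (Vxu x)) opprK /ns_mean.
rewrite (eq_bigr (fun z => ns_law x (z.1, z.2) * ns_llr x (z.1, z.2))) => [|[] //].
rewrite -(pair_bigA _ (fun a b => ns_law x (a, b) * ns_llr x (a, b))) /=.
rewrite /ns_law /ns_llr /=; under eq_bigr do under eq_bigr do rewrite mulrBr.
under eq_bigr do rewrite sumrB; rewrite sumrB; congr (_ - _).
  apply: eq_bigr => a _; under eq_bigr do rewrite mulrAC.
  by rewrite -mulr_sumr (sum_overlapr (Vxu x) Vu) mulr1.
rewrite exchange_big; apply: eq_bigr => b _ /=.
by rewrite Wx outp_overlap mulr_suml.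
Qed.

(** The event of [nussbaum_szkola] fails only if the log-likelihood ratio exceeds [g], hence its
    mean by [l dl]; Chernoff's bound makes this unlikely. *)
Lemma converse_single l (x : 'I_l -> X) (T : 'M[C]_(q_tdim d l)) dl g :
  0 < dl -> q_psd T -> q_psd (1%:M - T) ->
  \sum_i ns_mean (x i) + l%:R * dl <= g ->
  2^-1 * (1 - expR (- (l%:R * chernoff_exp ns_bound dl))) <=
  ev (q_tens (fun i => W (x i))) (1%:M - T) +
  expR g * ev (q_tens (fun _ : 'I_l => dg V s)) T.
Proof.
move=> dl0 hT hT1 hg.
have r0 i a : 0 <= rx (x i) a by case: (rx_pdist (x i)).
pose rl := prodw (fun i => rx (x i)); pose sl := prodw (fun _ : 'I_l => s).
have rl0 k : 0 <= rl k by exact: prodw_ge0.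
have sl0 k : 0 < sl k by apply: prodr_gt0.
have NS := nussbaum_szkola (tens_unitary (fun i => Vxu (x i)))
  (tens_unitary (fun _ : 'I_l => Vu)) (fun k => rl0 (wd k)) (fun k => ltW (sl0 (wd k)))
  (expR_ge0 g) hT hT1.
rewrite -!tens_dg in NS.
rewrite (tens_ext (fun i => Wx (x i))); apply: le_trans NS; rewrite ler_wpM2l //.
pose w i := ns_law (x i).
have w0 i z : 0 <= w i z := proj1 (ns_law_pdist (x i)) z.
have wf (f : {ffun 'I_l -> 'I_d * 'I_d}) : prodw w f = rl [ffun i => (f i).1] *
    \prod_i overlap (Vx (x i)) V (f i).1 (f i).2.
  by rewrite /rl /prodw -big_split; apply: eq_bigr => i _; rewrite ffunE.
pose good (f : {ffun 'I_l -> 'I_d * 'I_d}) :=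
  rl [ffun i => (f i).1] <= expR g * sl [ffun i => (f i).2].
have -> : \sum_a \sum_b (if rl (wd a) <= expR g * sl (wd b) then
      rl (wd a) * overlap (q_tens (fun i => Vx (x i))) (q_tens (fun=> V)) a b else 0) =
    \sum_(f | good f) prodw w f.
  pose G (a b : {ffun 'I_l -> 'I_d}) := if rl a <= expR g * sl b then
     rl a * \prod_i overlap (Vx (x i)) V (a i) (b i) else 0.
  transitivity (\sum_a \sum_b G a b).
    rewrite -sum_wd; apply: eq_bigr => a _; rewrite -sum_wd; apply: eq_bigr => b _.
    by rewrite overlap_tens.
  rewrite sum_pair_words [RHS]big_mkcond; apply: eq_bigr => f _.
  rewrite /G /good wf; case: ifP => // _; congr (_ * _).
  by apply: eq_bigr => i _; rewrite !ffunE.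
have w1 : \sum_f prodw w f = 1.
  by apply: prodw_sum1 => i; exact: (proj2 (ns_law_pdist (x i))).
rewrite lerBlDr -[leLHS]w1.
rewrite (bigID good) /= lerD2l.
have B0 := ns_bound_ge0.
apply: le_trans (chernoff_tail B0 dl0 (fun i => ns_law_pdist (x i)) (fun i => ns_llr_le (x i))).
rewrite [leLHS]big_mkcond [leRHS]big_mkcond; apply: ler_sum => f _.
case: ifPn => [bad|_]; last by case: ifP => // _; exact: prodw_ge0.
(* If some eigenvalue vanishes, the word has weight 0; otherwise logarithms may be taken. *)
have [r_gt0|] := boolP [forall i, 0 < rx (x i) (f i).1]; last first.
  case/forallPn => i; rewrite -leNgt => ri.
  have -> : prodw w f = 0.
    rewrite /prodw (bigD1 i) //= /w /ns_law (@le_anti _ R (rx _ _) 0) ?mul0r //.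
    by rewrite ri r0.
  by case: ifP => // _; exact: prodw_ge0.
move/forallP: r_gt0 => r_gt0; rewrite ifT //.
apply: le_trans hg _; rewrite sumrB lerBrDr.
move: bad; rewrite /good -ltNge => /ltW.
have -> : rl [ffun i => (f i).1] = expR (\sum_i ln (rx (x i) (f i).1)).
  by rewrite expR_sum /rl /prodw; apply: eq_bigr => i _; rewrite ffunE lnK // posrE.
have -> : sl [ffun i => (f i).2] = expR (\sum_i ln (s (f i).2)).
  by rewrite expR_sum /sl /prodw; apply: eq_bigr => i _; rewrite ffunE lnK // posrE.
by rewrite -expRD ler_expR.
Qed.

(** Messages have different means, but by Markov's inequality a fraction [dl / (dl + 2 * ns_bound)]
    of them lies below the average plus [l dl]. These share one threshold [g], and their second-kind
    errors sum to at most [expR g] because the decoding operators sum to at most 1. *)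
Lemma converse_block l M (u : 'I_M -> 'I_l -> X) (D : 'I_M -> 'M[C]_(q_tdim d l)) dl :
  (0 < l)%N -> (0 < M)%N -> 0 < dl -> q_decoder_valid D ->
  M%:R * (dl / (dl + 2 * ns_bound) * (2^-1 * (1 - expR (- (l%:R * chernoff_exp ns_bound dl))))
     - q_code_err (fun=> W) u D)
  <= expR (M%:R^-1 * \sum_m \sum_i ns_mean (u m i) + 2 * (l%:R * dl)).
Proof.
move=> l0 M0 dl0 hD; have [D0 D1] := hD; have D1m m := decoder_compl_psd m hD.
have lR : 0 < l%:R :> R by rewrite ltr0n.
have MR : 0 < M%:R :> R by rewrite ltr0n.
have B0 := ns_bound_ge0.
set h := 2^-1 * _; set avg := M%:R^-1 * _; set err := q_code_err _ _ _.
pose mu m := \sum_i ns_mean (u m i).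
have mu_le m : `|mu m| <= l%:R * ns_bound.
  apply: le_trans (ler_norm_sum _ _ _) _.
  apply: (@le_trans _ _ (\sum_(i < l) ns_bound)); last by rewrite sumr_const card_ord mulr_natl.
  by apply: ler_sum => i _; exact: ns_mean_le.
have avgE : M%:R * avg = \sum_m mu m by rewrite /avg mulrA divff ?mul1r // gt_eqF.
have avg_le : avg <= l%:R * ns_bound.
  rewrite -(ler_pM2l MR) avgE.
  apply: (@le_trans _ _ (\sum_(m < M) l%:R * ns_bound)); last by rewrite sumr_const card_ord [leRHS]mulr_natl.
  by apply: ler_sum => m _; apply: le_trans (ler_norm _) (mu_le m).
pose G := [set m | mu m <= avg + l%:R * dl]%SET.
(* messages outside G exceed the average by l dl, and none is below it by more than 2 l B *)
have hG : M%:R * (dl / (dl + 2 * ns_bound)) <= #|G|%:R.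
  have pos : 0 < dl + 2 * ns_bound by rewrite ltr_wpDr // mulr_ge0.
  rewrite mulrA ler_pdivrMr //.
  have key : \sum_m (avg + l%:R * dl - (m \in G)%:R * (l%:R * (dl + 2 * ns_bound))) <= \sum_m mu m.
    apply: ler_sum => m _; rewrite inE; case: (leP (mu m) (avg + _)) => /= hm.
      have /ler_normlP[] := mu_le m; lra.
    by rewrite mul0r subr0 ltW.
  move: key; rewrite sumrB -mulr_suml sumr_const card_ord -natr_sum.
  have -> : (\sum_m (m \in G))%N = #|G|.
    by rewrite -sum1_card [RHS]big_mkcond; apply: eq_bigr => m _; case: (m \in G).
  rewrite -avgE -[(_ + _) *+ M]mulr_natl => key.
  rewrite -(ler_pM2l lR); move: key; rewrite mulrDr; lra.
have hsum : #|G|%:R * h <= M%:R * err + expR (avg + 2 * (l%:R * dl)).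
  have one m : m \in G -> h <= ev (q_tens (fun i => W (u m i))) (1%:M - D m) +
      expR (avg + 2 * (l%:R * dl)) * ev (q_tens (fun _ : 'I_l => dg V s)) (D m).
    rewrite inE => hm; apply: converse_single => //; move: hm; rewrite /mu; lra.
  rewrite mulr_natl -sumr_const.
  apply: le_trans (ler_sum _ one) _; rewrite big_split /=.
  have Wst x : q_is_state (W x) by rewrite Wx; apply: dg_state.
  have sst : q_is_state (q_tens (fun _ : 'I_l => dg V s)).
    by apply: tens_state => _; apply: dg_state.
  apply: lerD.
    rewrite /err /q_code_err mulrA divff ?(gt_eqF MR) // mul1r.
    rewrite [leRHS](bigID (mem G)) /= lerDl sumr_ge0 // => m _.
    by apply: (ev_ge0 _ (D1m m)); apply: tens_psd => i; case: (Wst (u m i)).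
  rewrite -mulr_sumr -[leRHS]mulr1 ler_wpM2l ?expR_ge0 // -(ev_state1 sst) -ev_sumr.
  have [sp _] := sst; apply: (ler_ev sp).
  have -> : 1%:M - \sum_(m in G) D m = (1%:M - \sum_m D m) + \sum_(m | m \notin G) D m.
    by rewrite [\sum_m D m](bigID (mem G)) /= opprD addrA subrK.
  by apply: (psdD D1); apply: psd_sum => m' _; exact: D0.
rewrite mulrBr lerBlDl; apply: le_trans hsum; rewrite mulrA ler_wpM2r // /h.
rewrite mulr_ge0 // subr_ge0 -[leRHS]expR0 ler_expR oppr_le0 mulr_ge0 //.
exact/ltW/chernoff_exp_gt0.
Qed.
End Converse.

(** The bounds on [Q] and [err] leave at least [c / 4 - c / 8 = c / 8] in the factor of [M]. *)
Lemma ln_block_bound {R : realType} (M : nat) (c A err Q K : R) :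
  (0 < M)%N -> 0 < c -> err <= c / 8 -> Q <= 2^-1 -> ln (8 / c) <= K ->
  M%:R * (c * (2^-1 * (1 - Q)) - err) <= expR A -> ln M%:R <= A + K.
Proof.
move=> M0 c0 he hQ hK h.
have MR : 0 < M%:R :> R by rewrite ltr0n.
have c8 : 0 < 8 / c by rewrite divr_gt0.
have h1 : c / 8 <= c * (2^-1 * (1 - Q)) - err.
  have : 0 <= c * (2^-1 - Q) by rewrite mulr_ge0 ?subr_ge0 // ltW.
  lra.
have h2 : M%:R <= 8 / c * expR A.
  have := le_trans (ler_wpM2l (ltW MR) h1) h.
  rewrite -(ler_pM2l c8); congr (_ <= _); field; exact: lt0r_neq0.
apply: le_trans (_ : ln (8 / c * expR A) <= _).
  by rewrite ler_ln ?posrE // mulr_gt0 // expR_gt0.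
by rewrite lnM ?posrE ?expR_gt0 // expRK addrC lerD2l.
Qed.

(** * Letter frequencies and their cluster points *)

Definition letter_freq {R : realType} (X : finType) l M (u : 'I_M -> 'I_l -> X) (x : X) : R :=
  (M%:R * l%:R)^-1 * \sum_m \sum_i (u m i == x)%:R.

Lemma letter_freq_mean {R : realType} (X : finType) l M (u : 'I_M -> 'I_l -> X) (f : X -> R) :
  (0 < l)%N -> M%:R^-1 * \sum_m \sum_i f (u m i) = l%:R * \sum_x letter_freq u x * f x.
Proof.
move=> l0; have lR : l%:R != 0 :> R by rewrite pnatr_eq0 -lt0n.
have -> : \sum_m \sum_i f (u m i) = \sum_x (\sum_m \sum_i (u m i == x)%:R) * f x.
  under [RHS]eq_bigr do rewrite mulr_suml.
  rewrite [RHS]exchange_big; apply: eq_bigr => m _ /=; under [RHS]eq_bigr do rewrite mulr_suml.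
  rewrite [RHS]exchange_big; apply: eq_bigr => i _ /=.
  rewrite (bigD1 (u m i)) //= eqxx mul1r big1 ?addr0 // => x.
  by rewrite eq_sym => /negPf ->; rewrite mul0r.
rewrite /letter_freq; under [in RHS]eq_bigr do rewrite -mulrA.
by rewrite -mulr_sumr mulrA; congr (_ * _); rewrite invfM mulrCA mulfV // mulr1.
Qed.

Lemma letter_freq_pdist {R : realType} (X : finType) l M (u : 'I_M -> 'I_l -> X) :
  (0 < l)%N -> (0 < M)%N -> q_pdist (letter_freq u : X -> R).
Proof.
move=> l0 M0; have lR : l%:R != 0 :> R by rewrite pnatr_eq0 -lt0n.
have MR : M%:R != 0 :> R by rewrite pnatr_eq0 -lt0n.
split=> [x|].
  by rewrite mulr_ge0 ?invr_ge0 ?mulr_ge0 // sumr_ge0 // => m _; apply: sumr_ge0.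
have := letter_freq_mean u (fun=> 1) l0 (R := R).
rewrite (eq_bigr (fun=> l%:R)) => [|m _]; last by rewrite sumr_const card_ord.
rewrite sumr_const card_ord -[l%:R *+ M]mulr_natl mulrA mulVf // mul1r => h.
by apply: (mulfI lR); rewrite mulr1 [RHS]h; congr (_ * _); apply: eq_bigr => x _; rewrite mulr1.
Qed.

(** Compactness of the cube gives a cluster point, at which every closed half-space condition that
    eventually holds persists, simultaneously for all [g]. Normalization is the case of constant
    [g], equal to 1 and to -1. *)
Lemma simplex_cluster {R : realType} (X : finType) (P : nat -> X -> R) :
  (forall n, (0 < n)%N -> q_pdist (P n)) ->
  exists p : X -> R, q_pdist p /\
    forall (g : X -> R) c, (\forall n \near \oo, c <= \sum_x P n x * g x) ->
      c <= \sum_x p x * g x.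
Proof.
move=> hP; pose K := [set v : 'rV[R]_#|X| | forall i, `[0, 1]%classic (v ord0 i)].
have cK : compact K.
  by apply: (@rV_compact R _ (fun=> `[0, 1]%classic)) => i; exact: segment_compact.
pose rowP n : 'rV[R]_#|X| := \row_i P n (enum_val i).
pose F := rowP @ \oo.
have FK : F K.
  change (\forall n \near \oo, K (rowP n)).
  near=> n => i; rewrite /rowP mxE /= in_itv /=.
  have n0 : (0 < n)%N by near: n; exact: nbhs_infty_gt.
  have [p0 p1] := hP n n0; rewrite p0 /=; exact: (pdist_le1 _ (hP n n0)).
have [v [Kv clv]] := cK F _ FK.
pose p x := v ord0 (enum_rank x).
have lin (g : X -> R) c : (\forall n \near \oo, c <= \sum_x P n x * g x) ->
    c <= \sum_x p x * g x.
  move=> hc; rewrite leNgt; apply/negP => lt.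
  pose L (u : 'rV[R]_#|X|) := \sum_x u ord0 (enum_rank x) * g x.
  have Lc : {for v, continuous L}.
    apply: continuous_big => [|x _ u]; first exact: add_continuous.
    have h1 := @coord_continuous R 1 #|X| ord0 (enum_rank x) u.
    exact: (cvgM h1 (cvg_cst (g x))).
  have B : \forall u \near v, L u < c by apply: (cvgr_lt _ Lc _ lt).
  have A : F [set u | c <= L u].
    apply: filterS hc => n /= h; apply: le_trans h _; rewrite le_eqVlt; apply/orP; left.
    by apply/eqP; apply: eq_bigr => x _; rewrite mxE enum_rankK.
  have [u [/= h1 h2]] := clv _ _ A B.
  by move: (le_lt_trans h1 h2); rewrite ltxx.
exists p; split=> //; split=> [x|].
  by have := Kv (enum_rank x); rewrite /= in_itv /= => /andP[].
have ev1 : \forall n \near \oo, \sum_x P n x = 1.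
  near=> n; have n0 : (0 < n)%N by near: n; exact: nbhs_infty_gt.
  by case: (hP n n0).
apply/eqP; rewrite eq_le; apply/andP; split.
  have := lin (fun=> -1) (-1); under eq_bigr do rewrite mulrN1.
  rewrite sumrN lerN2; apply; apply: filterS ev1 => n h.
  by under eq_bigr do rewrite mulrN1; rewrite sumrN h.
have := lin (fun=> 1) 1; under eq_bigr do rewrite mulr1.
apply; apply: filterS ev1 => n h.
by under eq_bigr do rewrite mulr1; rewrite h.
Unshelve. all: by end_near.
Qed.

(** The relative entropy of [W x] to [dg V s] in nats, in the form of [ns_meanE]. *)
Definition rel_term {R : realType} (X : finType) d (W : X -> 'M[R[i]]_d)
    (V : 'M[R[i]]_d) (s : 'I_d -> R) (x : X) : R :=
  - (ln 2 * q_entropy (W x)) - \sum_b outp V (W x) b * ln (s b).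

(** The letter frequencies depend only on the code, which does not know [W], and the bound is linear
    in them; hence one [p] works for all [W], [V] and [s]. *)
Lemma converse_rate {R : realType} (X : finType) d (Wset : set (X -> 'M[R[i]]_d)) (r : R) :
  (forall W, Wset W -> forall x, q_is_state (W x)) -> q_det_achievable Wset r ->
  exists p : X -> R, q_pdist p /\
    forall W V s, Wset W -> V \is unitarymx -> q_pdist s -> (forall b, 0 < s b) ->
      r * ln 2 <= \sum_x p x * rel_term W V s x.
Proof.
move=> hst [M [u [D [M0 [hD [hr herr]]]]]].
have L0 := @ln2_gt0 R.
have [p [hp lin]] := @simplex_cluster R X (fun l => letter_freq (u l))
  (fun l l0 => letter_freq_pdist (u l) l0 (M0 l)).
exists p; split=> // W V s hW Vu hs s0.
apply/ler_addgt0Pr => e e0; rewrite -lerBlDr.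
apply: lin.
have [Vx hVx] := choice (fun x => state_spectral (hst W hW x)).
have [rx hrx] := choice hVx.
have Vxu x : Vx x \is unitarymx by case: (hrx x).
have rxp x : q_pdist (rx x) by case: (hrx x).
have Wx x : W x = dg (Vx x) (rx x) by case: (hrx x).
set B := ns_bound rx s.
(* The rate approximation costs [e / 2], the block bound [2 dl] and the constant [ln (8 / c)] at
   most [dl] per letter: less than [e] in total. *)
pose dl := e / 8; have dl0 : 0 < dl by rewrite divr_gt0.
have B0 : 0 <= B by exact: ns_bound_ge0.
pose c := dl / (dl + 2 * B).
have c0 : 0 < c by rewrite divr_gt0 // ltr_wpDr // mulr_ge0.
pose cc := chernoff_exp B dl; have cc0 : 0 < cc by exact: chernoff_exp_gt0.
have e20 : 0 < e / 2 / ln 2 by rewrite !divr_gt0.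
near=> l.
have l0 : (0 < l)%N by near: l; exact: nbhs_infty_gt.
have lR : 0 < l%:R :> R by rewrite ltr0n.
have hrate : r - e / 2 / ln 2 < q_log2 (M l)%:R / l%:R.
  by near: l; exact: (limn_einf_lt e20 hr).
have he : q_code_err (fun=> W) (u l) (D l) <= c / 8.
  have : (ereal_sup [set (q_code_err (fun=> W) (u l) (D l))%:E | W in Wset] < (c / 8)%:E)%E.
    near: l; apply: (herr [set z | z < (c / 8)%:E]%E).
    by apply: open_ereal_lt'; rewrite lte_fin divr_gt0.
  move=> h; rewrite -lee_fin; apply: le_trans (ltW h); apply: ereal_sup_ubound.
  by exists W.
have hQ : expR (- (l%:R * cc)) <= 2^-1.
  have : cc^-1 <= l%:R by near: l; exact: nbhs_infty_ger.
  rewrite -(ler_pM2r cc0) mulVf ?gt_eqF // => h.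
  rewrite expRN lef_pV2 ?posrE ?expR_gt0 //.
  by apply: le_trans (expR_ge1Dx _); lra.
have hK : ln (8 / c) <= l%:R * dl.
  rewrite -ler_pdivrMr //; near: l; exact: nbhs_infty_ger.
have blk := converse_block Vxu rxp Wx Vu hs s0 (u l) l0 (M0 l) dl0 (hD l).
have := ln_block_bound (M0 l) c0 he hQ hK blk.
rewrite (letter_freq_mean (u l) _ l0) => hM.
have -> : \sum_x letter_freq (u l) x * rel_term W V s x =
    \sum_x letter_freq (u l) x * ns_mean Vx rx V s x.
  by apply: eq_bigr => x _; rewrite (ns_meanE s Vxu Wx Vu).
set m := \sum_x _ in hM *.
move: hrate; rewrite /q_log2 ltr_pdivlMr // ltr_pdivlMr // => hrate.
have hlt := lt_le_trans hrate hM.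
have : l%:R * (r * ln 2 - e) < l%:R * m.
  have -> : l%:R * (r * ln 2 - e) = (r - e / 2 / ln 2) * l%:R * ln 2 - l%:R * (4 * dl).
    by rewrite /dl; field; rewrite gt_eqF.
  have : 0 < l%:R * dl by rewrite mulr_gt0.
  move: hlt; lra.
by rewrite ltr_pM2l // => /ltW.
Unshelve. all: by end_near.
Qed.

(* With sigma = (1 - eta) W_p + eta / d, letting eta -> 0. *)
Lemma rel_term_holevo {R : realType} (X : finType) d (W : X -> 'M[R[i]]_d) (p : X -> R) (c : R) :
  q_pdist p -> (forall x, q_is_state (W x)) ->
  (forall V s, V \is unitarymx -> q_pdist s -> (forall b, 0 < s b) ->
     c * ln 2 <= \sum_x p x * rel_term W V s x) ->
  c <= q_holevo p W.
Proof.
move=> hp hW h; have L0 := @ln2_gt0 R.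
have [V [r [Vu hr Wp]]] := state_spectral (mix_state hp hW).
rewrite -(ler_pM2l L0) [ln 2 * c]mulrC; apply/ler_addgt0Pr => e e0.
(* Then [ln (1 - k) = - e], exactly the loss allowed. *)
pose k := 1 - expR (- e).
have k0 : 0 < k by rewrite subr_gt0 expR_lt1 oppr_lt0.
have k1 : k < 1 by rewrite ltrBlDr ltrDl expR_gt0.
have [r0 r1] := hr.
have hs : q_pdist (smooth k r).
  split=> [b|]; last exact: smooth_sum.
  by apply: ltW; apply: smooth_gt0.
apply: le_trans (h V _ Vu hs _) _ => [b|]; first exact: smooth_gt0.
rewrite /rel_term; under eq_bigr do rewrite mulrBr.
rewrite sumrB /q_holevo mulrBr.
have -> : \sum_x p x * - (ln 2 * q_entropy (W x)) = - (ln 2 * \sum_x p x * q_entropy (W x)).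
  by rewrite mulr_sumr -sumrN; apply: eq_bigr => x _; rewrite mulrN mulrCA.
rewrite Wp (entropy_nat _ Vu).
(* The basis [V] diagonalizes the mean output, so the outcome laws average to its spectrum [r]. *)
have -> : \sum_x p x * (\sum_b outp V (W x) b * ln (smooth k r b)) =
    \sum_b r b * ln (smooth k r b).
  under eq_bigr do rewrite mulr_sumr; rewrite exchange_big; apply: eq_bigr => b _ /=.
  rewrite -[in RHS](outp_dg r b Vu) -Wp outp_suml mulr_suml.
  by apply: eq_bigr => x _; rewrite mulrA.
have : \sum_b r b * ln (r b) + ln (1 - k) <= \sum_b r b * ln (smooth k r b).
  rewrite [X in _ + X](mean_const _ hr) -big_split /=; apply: ler_sum => b _.
  have [->|bn0] := eqVneq (r b) 0; first by rewrite !mul0r addr0.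
  have bp : 0 < r b by rewrite lt_def bn0 r0.
  have kp : 0 < 1 - k by rewrite subr_gt0.
  rewrite -mulrDr ler_wpM2l // [leLHS]addrC.
  have <- : ln ((1 - k) * r b) = ln (1 - k) + ln (r b) by apply: lnM.
  rewrite ler_ln ?posrE ?mulr_gt0 ?smooth_gt0 //.
  by rewrite lerDl ltW // smooth_floor_gt0.
have -> : ln (1 - k) = - e by rewrite /k subKr expRK.
lra.
Qed.

Lemma inf_le_sup {R : realType} (Q : R -> Prop) (x : \bar R) :
  (forall r, (r%:E < x)%E -> Q r) -> (x <= ereal_sup [set r%:E | r in Q])%E.
Proof.
case: x => [x| |] h.
- apply/lee_subgt0Pr => e e0; apply: ereal_sup_ubound; exists (x - e) => //.
  by apply: h; rewrite lte_fin ltrBlDr ltrDl.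
- rewrite leye_eq; apply/eqP; apply/eq_infty => r.
  by apply: ereal_sup_ubound; exists r => //; apply: h; rewrite ltry.
- exact: leNye.
Qed.

(** * Capacities and the Holevo infimum *)

Section Capacity.
Context {R : realType}.
Variables (X S : finType) (d : nat) (A : S -> X -> 'M[R[i]]_d).
Hypotheses (hX : (0 < #|X|)%N) (hS : (0 < #|S|)%N).
Hypothesis (hA : forall s x, q_is_state (A s x)).

(** The infimum is an extended real; this extracts a real [I] that can be used as a rate bound. *)
Lemma lt_inf_holevo (p : X -> R) (r : R) :
  (r%:E < ereal_inf [set (q_holevo p W)%:E | W in q_conv A])%E ->
  exists2 I, r < I & forall W, q_conv A W -> I <= q_holevo p W.
Proof.
set i := ereal_inf _ => ri.
have hi W : q_conv A W -> (i <= (q_holevo p W)%:E)%E.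
  by move=> hW; apply: ereal_inf_lbound; exists W.
case: i ri hi => [I| |] ri hi.
- by exists I => // W hW; rewrite -lee_fin hi.
- by exists (r + 1) => [|W /hi]; rewrite ?ltrDl // leye_eq.
- by move: ri; rewrite ltNge leNye.
Qed.

Lemma compound_capacity_ge (p : X -> R) : q_pdist p ->
  (ereal_inf [set (q_holevo p W)%:E | W in q_conv A] <= q_cap_compound (q_conv A))%E.
Proof.
move=> hp; apply: inf_le_sup => r /lt_inf_holevo[I rI hI].
exact: compound_achievable hX hS hA hp hI rI.
Qed.

Lemma random_capacity_ge (p : X -> R) : q_pdist p ->
  (ereal_inf [set (q_holevo p W)%:E | W in q_conv A] <= q_cap_random A)%E.
Proof.
move=> hp; apply: inf_le_sup => r /lt_inf_holevo[I rI hI].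
exact: random_achievable hX hS hA hp hI rI.
Qed.

(** The law given by [converse_rate] may depend on the rate, so a second cluster point is taken
    along rates increasing to the capacity; the limit law attains the maximum. *)
Lemma compound_capacity_le : exists p : X -> R, q_pdist p /\
  (q_cap_compound (q_conv A) <= ereal_inf [set (q_holevo p W)%:E | W in q_conv A])%E.
Proof.
have L0 := @ln2_gt0 R.
have hst W (hW : q_conv A W) := conv_state hA hW.
have [W0 hW0] := conv_nonempty A hS.
have d0 := dim_gt0 hX hS hA.
set cap := q_cap_compound _.
(* The maximally mixed reference state: its relative entropies bound all achievable rates uniformly
   in [p], so the capacity is finite. *)
pose s0 (b : 'I_d) : R := d%:R^-1.
have s0p : q_pdist s0.
  split=> [b|]; first by rewrite invr_ge0.
  by rewrite sumr_const card_ord /s0 -[LHS]mulr_natl mulfV // pnatr_eq0 -lt0n.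
have V1 : (1%:M : 'M[R[i]]_d) \is unitarymx by apply/unitarymxP; rewrite dag1 mulmx1.
pose K := \sum_x `|rel_term W0 1%:M s0 x|.
have cap_le : (cap <= (K / ln 2)%:E)%E.
  apply: ge_ereal_sup => _ [r hr <-]; rewrite lee_fin ler_pdivlMr //.
  have [p [hp h]] := converse_rate hst hr; have [p0 _] := hp.
  apply: le_trans (h W0 1%:M s0 hW0 V1 s0p _) _ => [b|]; first by rewrite invr_gt0 ltr0n.
  apply: ler_sum => x _; apply: le_trans (ler_norm _) _; rewrite normrM ger0_norm //.
  by rewrite ler_piMl // (pdist_le1 _ hp).
have cap_ge : (0 <= cap)%E.
  by apply: ereal_sup_ubound; exists 0 => //; exact: trivial_achievable.
have [c capE] : exists c, cap = c%:E.
  exists (fine cap); rewrite fineK // fin_numElt (lt_le_trans _ cap_ge) ?ltNy0 //.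
  by rewrite (le_lt_trans cap_le) ?ltry.
have hn n : exists p : X -> R, q_pdist p /\ forall W V s, q_conv A W -> V \is unitarymx ->
    q_pdist s -> (forall b, 0 < s b) ->
    (c - n.+1%:R^-1) * ln 2 <= \sum_x p x * rel_term W V s x.
  have : ((c - n.+1%:R^-1)%:E < cap)%E by rewrite capE lte_fin ltrBlDr ltrDl invr_gt0.
  move=> /ereal_sup_gt[_ [r hr <-]]; rewrite lte_fin => cr.
  have [p [hp h]] := converse_rate hst hr; exists p; split=> // W V s hW Vu hs hs0.
  by apply: le_trans (h W V s hW Vu hs hs0); rewrite ler_wpM2r // ltW.
have [P hP] := choice hn.
have [p [hp lin]] := simplex_cluster (fun n _ => (hP n).1).
exists p; split=> //; apply: le_ereal_inf_tmp => _ [W hW <-]; rewrite capE lee_fin.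
apply: (rel_term_holevo hp (hst W hW)) => V s Vu hs hs0.
apply/ler_addgt0Pr => e e0; rewrite -lerBlDr; apply: lin; near=> n.
apply: le_trans ((hP n).2 W V s hW Vu hs hs0); rewrite mulrBl lerD2l lerN2.
have hle : e^-1 * ln 2 <= n%:R by near: n; exact: nbhs_infty_ger.
rewrite mulrC ler_pdivrMr // -ler_pdivrMl //; apply: le_trans hle _.
by rewrite ler_nat.
Unshelve. all: by end_near.
Qed.

End Capacity.

Local Open Scope classical_set_scope.
Local Open Scope ring_scope.
Local Open Scope ereal_scope.

Theorem theorem6 (R : realType) (X S : finType) (d : nat)
  (A : S -> X -> 'M[R[i]]_d)
  (hX : (0 < #|X|)%N) (hS : (0 < #|S|)%N)
  (hA : forall s x, q_is_state (A s x)) :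
  q_cap_compound (q_conv A) <= q_cap_random A /\
  (exists p : X -> R, q_pdist p /\
     q_cap_compound (q_conv A) = ereal_inf [set (q_holevo p W)%:E | W in q_conv A]) /\
  (forall p : X -> R, q_pdist p ->
     ereal_inf [set (q_holevo p W)%:E | W in q_conv A] <= q_cap_compound (q_conv A)).
Proof.
have [p [hp le]] := compound_capacity_le hX hS hA.
(* The two kinds of codes are not compared directly: at the law [p] of the converse, the Holevo
   infimum lies between the two capacities. *)
split; first exact: le_trans le (random_capacity_ge hX hS hA hp).
split; last exact: (compound_capacity_ge hX hS hA).
by exists p; split=> //; apply/le_anti; rewrite le compound_capacity_ge.
Qed.
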